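(* Let $\pi$ be a pyramid with $k$ boxes in its first row and $l$ in its second row. Take any $A=\substack{a_1\cdots a_k\\ b_1\cdots b_l}\in\mathrm{Tab}_\pi$ and let $h\ge0$ be maximal such that there exist distinct $1\le i_1,\dots,i_h\le k$ and distinct $1\le j_1,\dots,j_h\le l$ with $a_{i_1}=b_{j_1},\dots,a_{i_h}=b_{j_h}$. Choose $B\sim A$ so that $B$ has $h$ columns of height two containing equal entries. Then $\overline L(A)\cong\overline V(B)$. In particular $\dim\overline L(A)=2^{k-h}$.
   Context: Superalgebras are $\mathbb Z/2$-graded associative algebras over $\mathbb C$; $[x,y]=xy-(-1)^{|x||y|}yx$; tensor products use the usual sign convention $(a\otimes b)(c\otimes d)=(-1)^{|b||c|}ac\otimes bd$. Fix a parity sequence $(|1|,|2|)\in(\mathbb Z/2)^2$ with $|1|\ne|2|$. $\mathfrak{gl}_{1|1}$ has matrix units $e_{i,j}$ ($1\le i,j\le2$) of parity $|i|+|j|$; $U(\mathfrak{gl}_1)=\mathbb C[e_{1,1}]$. A pyramid $\pi$ is a collection of boxes in the plane in two connected rows, with $k$ boxes in the first (top) row and $l\ge k$ in the second (bottom) row, each box of the top row lying directly above a box of the bottom row. Columns are numbered $1,\dots,l$ from left to right. Row $i$ has parity $|i|$. Let $m$ (resp. $n$) be the number of boxes in the row of parity $\bar0$ (resp. $\bar1$); label the boxes of the even (resp. odd) row from left to right by $1,\dots,m$ (resp. $m+1,\dots,m+n$). Write $\mathrm{row}(i),\mathrm{col}(i)$ for the row and column of box $i$. A shift matrix is a $2\times2$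 matrix $\sigma=(s_{i,j})$ of non-negative integers with $s_{1,1}=s_{2,2}=0$; it is compatible with $\pi$ if either $k>0$ and $\pi$ has $s_{2,1}$ columns of height one on its left side and $s_{1,2}$ on its right side, or $k=0$ and $l=s_{2,1}+s_{1,2}$. Fix $\sigma$ compatible with $\pi$. Let $\mathfrak g=\mathfrak{gl}_{m|n}(\mathbb C)$, with matrix units $e_{i,j}$ of parity $|\mathrm{row}(i)|+|\mathrm{row}(j)|$, $\bar e_{i,j}=(-1)^{|\mathrm{row}(i)|}e_{i,j}$, $(x|y)=\mathrm{str}(xy)$. Let $e=\sum e_{i,j}$ over all $(i,j)$ such that box $j$ is immediately to the right of box $i$ in the same row; $\chi(x)=(x|e)$. Grade $\mathfrak g$ by $\deg(e_{i,j})=\mathrm{col}(j)-\mathrm{col}(i)$; $\mathfrak p=\bigoplus_{r\ge0}\mathfrak g(r)$, $\mathfrak h=\mathfrak g(0)$, $\mathfrak m=\bigoplus_{r<0}\mathfrak g(r)$, $\mathfrak m_\chi=\{x-\chi(x)\mid x\in\mathfrak m\}$. The principal $W$-algebra is $W_\pi=\{u\in U(\mathfrak p)\mid u\,\mathfrak m_\chi\subseteq\mathfrak m_\chi U(\mathfrak g)\}$. Write $i\prec j$ if $\mathrm{col}(i)<\mathrm{col}(j)$, or $\mathrm{col}(i)=\mathrm{col}(j)$ and $\mathrm{row}(i)<\mathrm{row}(j)$. Let $\tilde\rho(e_{j,j})=(-1)^{|\mathrm{row}(j)|}\big(\#\{i\mid i\preceq j,|\mathrm{row}(i)|=\bar1\}-\#\{i\mid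 i\prec j,|\mathrm{row}(i)|=\bar0\}\big)$ and let $S_{\pm\tilde\rho}$ be the automorphism $e_{i,j}\mapsto e_{i,j}\pm\delta_{i,j}\tilde\rho(e_{i,i})$ of $U(\mathfrak p)$. For $1\le i,j\le2$, $0\le\varsigma\le2$, $r\ge1$, $$t_{i,j;\varsigma}^{(r)}=S_{\tilde\rho}\Big(\sum_{s=1}^r(-1)^{r-s}\sum(-1)^{\#\{a=1,\dots,s-1\mid\mathrm{row}(j_a)\le\varsigma\}}\bar e_{i_1,j_1}\cdots\bar e_{i_s,j_s}\Big),$$ the inner sum over all $1\le i_1,\dots,i_s,j_1,\dots,j_s\le m+n$ such that: $\mathrm{row}(i_1)=i$, $\mathrm{row}(j_s)=j$; $\mathrm{col}(i_a)\le\mathrm{col}(j_a)$ for $1\le a\le s$; and for $1\le a\le s-1$: $\mathrm{row}(i_{a+1})=\mathrm{row}(j_a)$, $\mathrm{col}(i_{a+1})>\mathrm{col}(j_a)$ if $\mathrm{row}(j_a)>\varsigma$, $\mathrm{col}(i_{a+1})\le\mathrm{col}(j_a)$ if $\mathrm{row}(j_a)\le\varsigma$; and $\sum_a\deg(e_{i_a,j_a})=r-s$. Drinfeld generators of $W_\pi$: $d_1^{(r)}=t_{1,1;0}^{(r)}$, $d_2^{(r)}=t_{2,2;1}^{(r)}$ ($r>0$), $e^{(r)}=t_{1,2;1}^{(r)}$ ($r>s_{1,2}$), $f^{(r)}=t_{2,1;1}^{(r)}$ ($r>s_{2,1}$). Established fact fixing the setup: these elements lie in $W_\pi$ and identify $W_\pi$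 with the superalgebra generated by even $d_1^{(r)},d_2^{(r)}$ ($r>0$) and odd $e^{(r)}$ ($r>s_{1,2}$), $f^{(r)}$ ($r>s_{2,1}$) subject only to $d_1^{(r)}=0$ for $r>k$ and $$[d_i^{(r)},d_j^{(s)}]=[e^{(r)},e^{(s)}]=[f^{(r)},f^{(s)}]=0,\quad[e^{(r)},f^{(s)}]=(-1)^{|1|}\sum_{a=0}^{r+s-1}\tilde d_1^{(a)}d_2^{(r+s-1-a)},$$ $$[d_i^{(r)},e^{(s)}]=(-1)^{|1|}\sum_{a=0}^{r-1}d_i^{(a)}e^{(r+s-1-a)},\quad[d_i^{(r)},f^{(s)}]=-(-1)^{|1|}\sum_{a=0}^{r-1}f^{(r+s-1-a)}d_i^{(a)},$$ with $d_i^{(0)}=1$ and $\sum_{a=0}^r\tilde d_i^{(a)}d_i^{(r-a)}=\delta_{r,0}$. $W_\pi^0$ is the subalgebra generated by $d_1^{(r)}$ ($0<r\le k$), $d_2^{(s)}$ ($0<s\le l$), the polynomial algebra on these generators. $W_\pi^\sharp$ is the subalgebra generated by $W_\pi^0$ and $e^{(r)}$ ($s_{1,2}<r\le s_{1,2}+k$); it contains all $e^{(r)}$, $r>s_{1,2}$, and there is a unique surjection $W_\pi^\sharp\twoheadrightarrow W_\pi^0$ that is the identity on $W_\pi^0$ and kills all $e^{(r)}$ ($r>s_{1,2}$). A $\pi$-tableau is a filling of the boxes of $\pi$ by complex numbers; $\mathrm{Tab}_\pi$ is the set of all of them. The tableau with entries $a_1,\dots,a_k$ along its first row and $b_1,\dots,b_l$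 along its second row is written $\substack{a_1\cdots a_k\\ b_1\cdots b_l}$. $A\sim B$ means $B$ is obtained from $A$ by permuting entries within each row. For $A=\substack{a_1\cdots a_k\\ b_1\cdots b_l}$, $\mathbb C_A$ is the one-dimensional $W_\pi^0$-module with basis $1_A$ on which $d_1^{(r)}$ ($0<r\le k$) acts as $e_r(a_1,\dots,a_k)$ and $d_2^{(r)}$ ($0<r\le l$) as $e_r(b_1,\dots,b_l)$ ($e_r$ = $r$th elementary symmetric polynomial), viewed as a $W_\pi^\sharp$-module via $W_\pi^\sharp\twoheadrightarrow W_\pi^0$. $\overline M(A)=W_\pi\otimes_{W_\pi^\sharp}\mathbb C_A$, and $\overline L(A)$ is its unique irreducible quotient. Miura transform: identify $U(\mathfrak h)$ with $U_1\otimes\cdots\otimes U_l$, where $U_c=U(\mathfrak{gl}_{1|1})$ if column $c$ of $\pi$ has two boxes and $U_c=U(\mathfrak{gl}_1)$ if it has one, so that for $c=\mathrm{col}(i)=\mathrm{col}(j)$, $e_{i,j}$ becomes $1^{\otimes(c-1)}\otimes e_{\mathrm{row}(i),\mathrm{row}(j)}\otimes1^{\otimes(l-c)}$ (two boxes) or $1^{\otimes(c-1)}\otimes e_{1,1}\otimes1^{\otimes(l-c)}$ (one box). $\mu:W_\pi\to U(\mathfrak h)$ is the restriction of $\mathrm{pr}\circ S_{-\tilde\rho}$, where $\mathrm{pr}:U(\mathfrak p)\to U(\mathfrak h)$ is induced by the projection $\mathfrak p\twoheadrightarrow\mathfrak h$. Standard modules: for $A\in\mathrm{Tab}_\pi$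 let $A_c$ be its $c$th column. If $A_c$ has a single entry $b$, $\overline L(A_c)$ is the one-dimensional $U(\mathfrak{gl}_1)$-module with even basis vector $v_+$ and $e_{1,1}v_+=(-1)^{|2|}bv_+$. If $A_c$ has entries $a$ (first row) and $b$ (second row), $\overline L(A_c)$ is the irreducible $U(\mathfrak{gl}_{1|1})$-module generated by an even vector $v_+$ with $e_{1,1}v_+=(-1)^{|1|}av_+$, $e_{2,2}v_+=(-1)^{|2|}bv_+$, $e_{1,2}v_+=0$ (of dimension one if $a=b$, two otherwise). $\overline V(A)=\overline L(A_1)\otimes\cdots\otimes\overline L(A_l)$, the pull-back along $\mu$ of the outer tensor product. *)

(* Defs.v *)
From HB Require Import structures.
From mathcomp Require Import all_boot all_algebra perm.
From mathcomp Require Import boolp classical_sets.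

Set Implicit Arguments.
Unset Strict Implicit.
Unset Printing Implicit Defensive.

Import GRing.Theory.
Local Open Scope ring_scope.
Local Open Scope quotient_scope.

(** * Enveloping superalgebras of Lie superalgebras spanned by matrix units *)

(* For a finite set [I] with parity [p] and a transitive relation [P], the
   matrix units e_{i,j} with [P i j] span a Lie subsuperalgebra of the general
   linear Lie superalgebra on [I].  Its enveloping superalgebra [Ugl p P] is
   given by generators and relations: formal expressions modulo the least
   congruence that contains the axioms of associative unital [F]-algebras and
   the supercommutator relations.  A symbol e_{i,j} is kept for every pair, and
   it is set to 0 when [P i j] fails. *)

Section Enveloping.
Variables (F : fieldType) (I : finType) (p : I -> bool) (P : rel I).

Inductive uexp :=
  | UGen of I & I
  | UCst of F
  | UAdd of uexp & uexp
  | UMul of uexp & uexp.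

HB.instance Definition _ := gen_eqMixin uexp.
HB.instance Definition _ := gen_choiceMixin uexp.

(* (-1)^{|e_{i,j}| |e_{k,l}|} *)
Definition brsgn (i j k l : I) : F := (-1) ^+ ((p i (+) p j) && (p k (+) p l)).

Inductive ucong : uexp -> uexp -> Prop :=
  | ucong_refl x : ucong x x
  | ucong_sym x y : ucong x y -> ucong y x
  | ucong_trans x y z : ucong x y -> ucong y z -> ucong x z
  | ucongD x x' y y' : ucong x x' -> ucong y y' -> ucong (UAdd x y) (UAdd x' y')
  | ucongM x x' y y' : ucong x x' -> ucong y y' -> ucong (UMul x y) (UMul x' y')
  | ucong_addA x y z : ucong (UAdd x (UAdd y z)) (UAdd (UAdd x y) z)
  | ucong_addC x y : ucong (UAdd x y) (UAdd y x)
  | ucong_add0 x : ucong (UAdd (UCst 0) x) x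
  | ucong_mulA x y z : ucong (UMul x (UMul y z)) (UMul (UMul x y) z)
  | ucong_1mul x : ucong (UMul (UCst 1) x) x
  | ucong_0mul x : ucong (UMul (UCst 0) x) (UCst 0)
  | ucong_mulDl x y z : ucong (UMul (UAdd x y) z) (UAdd (UMul x z) (UMul y z))
  | ucong_mulDr x y z : ucong (UMul x (UAdd y z)) (UAdd (UMul x y) (UMul x z))
  | ucong_cstD a b : ucong (UCst (a + b)) (UAdd (UCst a) (UCst b))
  | ucong_cstM a b : ucong (UCst (a * b)) (UMul (UCst a) (UCst b))
  | ucong_cstC a x : ucong (UMul (UCst a) x) (UMul x (UCst a))
  | ucong_out i j : ~~ P i j -> ucong (UGen i j) (UCst 0)
  | ucong_br i j k l : P i j -> P k l ->
      ucong (UMul (UGen i j) (UGen k l))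
            (UAdd (UMul (UCst (brsgn i j k l)) (UMul (UGen k l) (UGen i j)))
                  (UAdd (UMul (UCst (j == k)%:R) (UGen i l))
                        (UMul (UCst (- (brsgn i j k l * (i == l)%:R)))
                              (UGen k j)))).

Definition ueq (x y : uexp) : bool := `[< ucong x y >].

Lemma ueq_is_equiv : equiv_class_of ueq.
Proof.
split=> [x|x y|y x z].
- by apply/asboolP; exact: ucong_refl.
- by apply/asboolP/asboolP => /ucong_sym.
- by move=> /asboolP xy /asboolP yz; apply/asboolP; exact: ucong_trans yz.
Qed.

Canonical ueq_equiv := EquivRelPack ueq_is_equiv.

Definition Ugl : Type := {eq_quot ueq}.

HB.instance Definition _ := Choice.on Ugl.
HB.instance Definition _ : EqQuotient uexp ueq Ugl := EqQuotient.on Ugl.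

Lemma ucongP x y : ucong x y <-> \pi_Ugl x = \pi_Ugl y.
Proof.
split=> [xy|]; first by apply/eqmodP/asboolP.
by move=> /eqmodP/asboolP.
Qed.

Lemma ucong_repr x : ucong (repr (\pi_Ugl x)) x.
Proof. by apply/ucongP; rewrite reprK. Qed.

Definition uadd (x y : Ugl) : Ugl := \pi_Ugl (UAdd (repr x) (repr y)).
Definition umul (x y : Ugl) : Ugl := \pi_Ugl (UMul (repr x) (repr y)).
Definition ucst (c : F) : Ugl := \pi_Ugl (UCst c).

Lemma uaddE x y : uadd (\pi_Ugl x) (\pi_Ugl y) = \pi_Ugl (UAdd x y).
Proof. by apply/ucongP; apply: ucongD; exact: ucong_repr. Qed.

Lemma umulE x y : umul (\pi_Ugl x) (\pi_Ugl y) = \pi_Ugl (UMul x y).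
Proof. by apply/ucongP; apply: ucongM; exact: ucong_repr. Qed.

Let upiW (Q : Ugl -> Prop) : (forall x, Q (\pi_Ugl x)) -> forall x, Q x.
Proof. by move=> h x; rewrite -[x]reprK. Qed.

Let uaddA : associative uadd.
Proof.
elim/upiW=> x; elim/upiW=> y; elim/upiW=> z.
by rewrite !uaddE; apply/ucongP; exact: ucong_addA.
Qed.
Let uaddC : commutative uadd.
Proof.
by elim/upiW=> x; elim/upiW=> y; rewrite !uaddE; apply/ucongP; exact: ucong_addC.
Qed.
Let uadd0 : left_id (ucst 0) uadd.
Proof. by elim/upiW=> x; rewrite uaddE; apply/ucongP; exact: ucong_add0. Qed.
Let umulA : associative umul.
Proof.
elim/upiW=> x; elim/upiW=> y; elim/upiW=> z.
by rewrite !umulE; apply/ucongP; exact: ucong_mulA.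
Qed.
Let u1mul : left_id (ucst 1) umul.
Proof. by elim/upiW=> x; rewrite umulE; apply/ucongP; exact: ucong_1mul. Qed.
Let ucstC c x : umul (ucst c) x = umul x (ucst c).
Proof. by elim/upiW: x => x; rewrite !umulE; apply/ucongP; exact: ucong_cstC. Qed.
Let umul1 : right_id (ucst 1) umul.
Proof. by move=> x; rewrite -ucstC u1mul. Qed.
Let umulDl : left_distributive umul uadd.
Proof.
elim/upiW=> x; elim/upiW=> y; elim/upiW=> z.
by rewrite !(uaddE, umulE); apply/ucongP; exact: ucong_mulDl.
Qed.
Let umulDr : right_distributive umul uadd.
Proof.
elim/upiW=> x; elim/upiW=> y; elim/upiW=> z.
by rewrite !(uaddE, umulE); apply/ucongP; exact: ucong_mulDr.
Qed.
Let ucstD a b : ucst (a + b) = uadd (ucst a) (ucst b).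
Proof. by rewrite uaddE; apply/ucongP; exact: ucong_cstD. Qed.
Let ucstM a b : ucst (a * b) = umul (ucst a) (ucst b).
Proof. by rewrite umulE; apply/ucongP; exact: ucong_cstM. Qed.
Let u0mul x : umul (ucst 0) x = ucst 0.
Proof. by elim/upiW: x => x; rewrite umulE; apply/ucongP; exact: ucong_0mul. Qed.
Let uaddN : left_inverse (ucst 0) (fun x => umul (ucst (-1)) x) uadd.
Proof. by move=> x; rewrite -{2}[x]u1mul -umulDl -ucstD addNr u0mul. Qed.

Fixpoint ueval (B : algType F) (g : I -> I -> B) (x : uexp) : B :=
  match x with
  | UGen i j => g i j
  | UCst c => c%:A
  | UAdd x y => ueval g x + ueval g y
  | UMul x y => ueval g x * ueval g y
  end.

Definition gl_rel (B : algType F) (g : I -> I -> B) : Prop :=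
  (forall i j, ~~ P i j -> g i j = 0) /\
  (forall i j k l, P i j -> P k l ->
     g i j * g k l - brsgn i j k l *: (g k l * g i j) =
     (j == k)%:R *: g i l - (brsgn i j k l * (i == l)%:R) *: g k j).

Lemma ueval_cong (B : algType F) (g : I -> I -> B) x y :
  gl_rel g -> ucong x y -> ueval g x = ueval g y.
Proof.
move=> [g0 gb]; elim=> //=.
- by move=> ? ? ? _ -> _ ->.
- by move=> ? ? ? ? _ -> _ ->.
- by move=> ? ? ? ? _ -> _ ->.
- by move=> *; rewrite addrA.
- by move=> *; rewrite addrC.
- by move=> *; rewrite scale0r add0r.
- by move=> *; rewrite mulrA.
- by move=> *; rewrite scale1r mul1r.
- by move=> *; rewrite scale0r mul0r.
- by move=> *; rewrite mulrDl.
- by move=> *; rewrite mulrDr.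
- by move=> *; rewrite scalerDl.
- by move=> *; rewrite mulr_algl scalerA.
- by move=> *; rewrite mulr_algl mulr_algr.
- by move=> i j /g0 ->; rewrite scale0r.
- move=> i j k l ij kl; rewrite !mulr_algl scaleNr -(gb _ _ _ _ ij kl).
  by rewrite addrC subrK.
Qed.

Let ucst1_neq0 : ucst 1 != ucst 0.
Proof.
apply/eqP => /ucongP h; have /eqP := oner_neq0 F; apply.
have /(_ (fun _ _ => 0)) := @ueval_cong F^o _ _ _ _ h.
rewrite /= scale0r /GRing.scale /= mulr1; apply.
by split=> // *; rewrite !(mulr0, scaler0) subrr.
Qed.

HB.instance Definition _ := GRing.isZmodule.Build Ugl uaddA uaddC uadd0 uaddN.
HB.instance Definition _ := GRing.Zmodule_isNzRing.Build Ugl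
  umulA u1mul umul1 umulDl umulDr ucst1_neq0.

Definition uscale (c : F) (x : Ugl) : Ugl := umul (ucst c) x.

Let uscaleA a b v : uscale a (uscale b v) = uscale (a * b) v.
Proof. by rewrite /uscale umulA ucstM. Qed.
Let uscale1 : left_id 1 uscale. Proof. exact: u1mul. Qed.
Let uscaleDr : right_distributive uscale +%R.
Proof. by move=> c x y; exact: umulDr. Qed.
Let uscaleDl v : {morph uscale^~ v : a b / a + b}.
Proof. by move=> a b; rewrite /uscale ucstD; exact: umulDl. Qed.

HB.instance Definition _ := GRing.Zmodule_isLmodule.Build F Ugl
  uscaleA uscale1 uscaleDr uscaleDl.

Let uscaleAl (c : F) (x y : Ugl) : c *: (x * y) = (c *: x) * y.
Proof. exact: umulA. Qed.
HB.instance Definition _ := GRing.Lmodule_isLalgebra.Build F Ugl uscaleAl.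
Let uscaleAr (c : F) (x y : Ugl) : c *: (x * y) = x * (c *: y).
Proof.
rewrite /GRing.scale /= /uscale.
change (umul (ucst c) (umul x y) = umul x (umul (ucst c) y)).
by rewrite !umulA ucstC.
Qed.
HB.instance Definition _ := GRing.Lalgebra_isAlgebra.Build F Ugl uscaleAr.

Definition ugen (i j : I) : Ugl := \pi_Ugl (UGen i j).

(* Z/2-grading of Ugl; [false] stands for even *)
Inductive ugr : bool -> Ugl -> Prop :=
  | ugr1 : ugr false 1
  | ugr_gen i j : ugr (p i (+) p j) (ugen i j)
  | ugrD q x y : ugr q x -> ugr q y -> ugr q (x + y)
  | ugrZ q c x : ugr q x -> ugr q (c *: x)
  | ugrM q r x y : ugr q x -> ugr r y -> ugr (q (+) r) (x * y)
  | ugr0 q : ugr q 0.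

Lemma ucstE c : \pi_Ugl (UCst c) = c%:A.
Proof.
rewrite /GRing.scale /= /uscale; change (ucst c = umul (ucst c) (ucst 1)).
by rewrite umul1.
Qed.

Lemma upiE x : \pi_Ugl x = ueval ugen x.
Proof.
elim: x => //= [c|x <- y <-|x <- y <-]; first exact: ucstE.
- by rewrite /GRing.add /= uaddE.
- by rewrite /GRing.mul /= umulE.
Qed.

Lemma ugen_rel : gl_rel ugen.
Proof.
split=> [i j ij|i j k l ij kl].
  by have := ucong_out ij; move/ucongP => /=; rewrite /ugen ucstE scale0r => ->.
have /ucongP := ucong_br ij kl; rewrite !upiE /= !mulr_algl => ->.
by rewrite addrC addKr scaleNr.
Qed.

Section Lift.
Variables (B : algType F) (g : I -> I -> B).

Definition ulift of gl_rel g : Ugl -> B := fun u => ueval g (repr u).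

Hypothesis hg : gl_rel g.

Lemma ulift_pi x : ulift hg (\pi_Ugl x) = ueval g x.
Proof. exact: ueval_cong (ucong_repr x). Qed.

Lemma ulift_gen i j : ulift hg (ugen i j) = g i j.
Proof. exact: ulift_pi. Qed.

Let uliftB : zmod_morphism (ulift hg).
Proof.
elim/upiW=> x; elim/upiW=> y.
have -> : \pi_Ugl x - \pi_Ugl y = \pi_Ugl (UAdd x (UMul (UCst (-1)) y)).
  by rewrite !upiE /= mulr_algl scaleN1r.
by rewrite !ulift_pi /= mulr_algl scaleN1r.
Qed.
HB.instance Definition _ := GRing.isZmodMorphism.Build Ugl B (ulift hg) uliftB.
Let uliftM : monoid_morphism (ulift hg).
Proof.
split.
  by have -> : 1 = \pi_Ugl (UCst 1) by []; rewrite ulift_pi /= scale1r.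
elim/upiW=> x; elim/upiW=> y.
have -> : \pi_Ugl x * \pi_Ugl y = \pi_Ugl (UMul x y) by rewrite !upiE.
by rewrite !ulift_pi.
Qed.
HB.instance Definition _ := GRing.isMonoidMorphism.Build Ugl B (ulift hg) uliftM.
Let uliftZ : scalable (ulift hg).
Proof.
move=> c; elim/upiW=> x.
have -> : c *: \pi_Ugl x = \pi_Ugl (UMul (UCst c) x).
  by rewrite !upiE /= mulr_algl.
by rewrite !ulift_pi /= mulr_algl.
Qed.
HB.instance Definition _ := GRing.isScalable.Build F Ugl B *:%R (ulift hg) uliftZ.

End Lift.

End Enveloping.

Lemma ulift_gr (F : fieldType) (I J : finType) (p : I -> bool) (q : J -> bool)
    (P : rel I) (Q : rel J) (g : I -> I -> Ugl F q Q)
    (hg : gl_rel p P g) :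
  (forall i j, ugr (p i (+) p j) (g i j)) ->
  forall r u, ugr r u -> ugr r (ulift hg u).
Proof.
move=> hgr r u; elim=> {r u}.
- by rewrite rmorph1; exact: ugr1.
- by move=> i j; rewrite ulift_gen.
- by move=> r x y _ hx _ hy; rewrite rmorphD; exact: ugrD.
- by move=> r c x _ hx; rewrite linearZ; exact: ugrZ.
- by move=> r s x y _ hx _ hy; rewrite rmorphM; exact: ugrM.
- by move=> r; rewrite rmorph0; exact: ugr0.
Qed.

(** * Subalgebras *)

Section Subalgebra.
Variables (F : fieldType) (A : algType F) (S : subalgClosed A).

Record subalg : predArgType := Subalg { subalg_val :> A; _ : subalg_val \in S }.

HB.instance Definition _ := [isSub for subalg_val].
HB.instance Definition _ := [Choice of subalg by <:].
HB.instance Definition _ := [SubChoice_isSubAlgebra of subalg by <:].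

Let subalg_valB : zmod_morphism subalg_val.
Proof. exact: (raddfB (\val : {additive subalg -> A})). Qed.
Let subalg_valM : monoid_morphism subalg_val.
Proof.
split; first exact: (rmorph1 (\val : {rmorphism subalg -> A})).
exact: (rmorphM (\val : {rmorphism subalg -> A})).
Qed.
Let subalg_valZ : scalable subalg_val.
Proof. by move=> c x; exact: (linearZZ (\val : {linear subalg -> A})). Qed.

HB.instance Definition _ := GRing.isZmodMorphism.Build _ _ subalg_val subalg_valB.
HB.instance Definition _ :=
  GRing.isMonoidMorphism.Build _ _ subalg_val subalg_valM.
HB.instance Definition _ :=
  GRing.isScalable.Build F _ _ *:%R subalg_val subalg_valZ.
End Subalgebra.
Arguments subalg_val {F A S}.

(* Subalgebra generated by a set *)
Section GeneratedSubalgebra.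
Variables (F : fieldType) (A : algType F) (G : set A).

Inductive galg_set : A -> Prop :=
  | galg_gen x : G x -> galg_set x
  | galg1 : galg_set 1
  | galgD x y : galg_set x -> galg_set y -> galg_set (x + y)
  | galgZ c x : galg_set x -> galg_set (c *: x)
  | galgM x y : galg_set x -> galg_set y -> galg_set (x * y).

Definition galg_pred : {pred A} := fun x => `[< galg_set x >].

Lemma galg_closed : subalg_closed galg_pred.
Proof.
split; first by apply/asboolP; exact: galg1.
- move=> c x y /asboolP hx /asboolP hy; apply/asboolP.
  by apply: galgD => //; exact: galgZ.
- move=> x y /asboolP hx /asboolP hy; apply/asboolP; exact: galgM.
Qed.

HB.instance Definition _ := GRing.isSubalgClosed.Build F A galg_pred galg_closed.

Definition galg : algType F := subalg galg_pred.
End GeneratedSubalgebra.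

(** * Supermodules *)

Section Supermodules.
Variables (F : fieldType) (A : algType F) (gA : bool -> A -> Prop).

(* [act] is the action and [gr] the grading, [false] being even *)
Record is_supermod (V : lmodType F) (act : A -> V -> V) (gr : bool -> V -> Prop)
    : Prop := IsSupermod {
  smod_actr : forall a, linear (act a);
  smod_actl : forall v, linear (act^~ v);
  smod_act1 : forall v, act 1 v = v;
  smod_actM : forall a b v, act (a * b) v = act a (act b v);
  smod_gr0 : forall q, gr q 0;
  smod_grP : forall q c u v, gr q u -> gr q v -> gr q (c *: u + v);
  smod_split : forall v, exists v0 v1, [/\ gr false v0, gr true v1 & v = v0 + v1];
  smod_disj : forall v, gr false v -> gr true v -> v = 0;
  smod_act_gr : forall q r a v, gA q a -> gr r v -> gr (q (+) r) (act a v) }.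

Record supermod := Supermod {
  smod_sort :> lmodType F;
  smod_act : A -> smod_sort -> smod_sort;
  smod_gr : bool -> smod_sort -> Prop;
  smodP : is_supermod smod_act smod_gr }.

Definition is_subsupermod (V : supermod) (N : set V) : Prop :=
  [/\ N 0,
      forall c u v, N u -> N v -> N (c *: u + v),
      forall a v, N v -> N (smod_act a v) &
      forall v0 v1, smod_gr false v0 -> smod_gr true v1 -> N (v0 + v1) ->
        N v0 /\ N v1].

Definition irreducible (V : supermod) : Prop :=
  (exists v : V, v <> 0) /\
  forall N : set V, is_subsupermod N -> N = [set 0]%classic \/ N = setT.

(* homomorphisms are even *)
Definition is_shom (V W : supermod) (f : {linear V -> W}) : Prop :=
  (forall a v, f (smod_act a v) = smod_act a (f v)) /\
  (forall q v, smod_gr q v -> smod_gr q (f v)).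

Definition sisom (V W : supermod) : Prop :=
  exists2 f : {linear V -> W}, is_shom f & bijective f.

Definition is_quotient (M L : supermod) : Prop :=
  exists2 f : {linear M -> L}, is_shom f & forall w, exists v, f v = w.

Definition unique_irreducible_quotient (M L : supermod) : Prop :=
  [/\ irreducible L, is_quotient M L &
      forall L', irreducible L' -> is_quotient M L' -> sisom L' L].

End Supermodules.

Definition has_dim (F : fieldType) (V : lmodType F) (d : nat) : Prop :=
  exists f : {linear V -> 'rV[F]_d}, bijective f.

(* Pull-back of a supermodule along an even algebra homomorphism *)
Section Pullback.
Variables (F : fieldType) (A B : algType F).
Variables (gA : bool -> A -> Prop) (gB : bool -> B -> Prop).
Variables (phi : {lrmorphism A -> B}).
Hypothesis phi_even : forall q a, gA q a -> gB q (phi a).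
Variable V : supermod gB.

Lemma pullback_subproof :
  is_supermod gA (fun a (v : V) => smod_act (phi a) v) (@smod_gr _ _ _ V).
Proof.
case: V => U act gr [? al ? ? ? ? ? ? ?]; split=> //=.
- by move=> v c a b; rewrite linearP al.
- by move=> v; rewrite rmorph1.
- by move=> a b v; rewrite rmorphM.
- by move=> q r a v /phi_even; auto.
Qed.

Definition pullback : supermod gA := Supermod pullback_subproof.
End Pullback.

(** * Pyramids *)

Notation row1 := (ord0 : 'I_2).
Notation row2 := (ord_max : 'I_2).

Record parity_seq := ParitySeq {
  rpar :> 'I_2 -> bool;
  rparP : rpar row1 != rpar row2 }.

(* [top] (resp. [bot]) boxes in the first (resp. second) row; the first row
   starts [off] columns to the right of the second one.  When [top] is 0, [off]
   carries no information. *)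
Record pyramid := Pyramid {
  top : nat;
  bot : nat;
  off : nat;
  pyramidP : (off + top <= bot)%N }.

(* rows of [s] are indexed from 0: [s row2 row1] is s_{2,1} *)
Definition compatible (pi : pyramid) (s : 'M[nat]_2) : Prop :=
  [/\ s row1 row1 = 0%N, s row2 row2 = 0%N &
      if (0 < top pi)%N
      then off pi = s row2 row1 /\ bot pi = (off pi + top pi + s row1 row2)%N
      else bot pi = (s row2 row1 + s row1 row2)%N].

Section Boxes.
Variables (par : parity_seq) (pi : pyramid).

Definition even_row : 'I_2 := if par row1 then row2 else row1.
Definition odd_row : 'I_2 := if par row1 then row1 else row2.
Definition rowlen (r : 'I_2) : nat := if r == row1 then top pi else bot pi.

(* Boxes are labelled from 0: first the even row, then the odd row. *)
Definition nbox : nat := (rowlen even_row + rowlen odd_row)%N.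

Definition brow (i : 'I_nbox) : 'I_2 :=
  if (i < rowlen even_row)%N then even_row else odd_row.

(* columns are numbered from 1 *)
Definition bcol (i : 'I_nbox) : nat :=
  ((if brow i == row1 then off pi else 0) +
   (if i < rowlen even_row then i : nat else i - rowlen even_row).+1)%N.

Definition bpar (i : 'I_nbox) : bool := par (brow i).

Lemma par_even_row : par even_row = false.
Proof.
have := rparP par; rewrite /even_row.
by case E : (par row1); case E2 : (par row2).
Qed.

Lemma par_odd_row : par odd_row = true.
Proof.
have := rparP par; rewrite /odd_row.
by case E : (par row1); case E2 : (par row2).
Qed.

Lemma box_inj i j : brow i = brow j -> bcol i = bcol j -> i = j.
Proof.
have eo : even_row <> odd_row.
  by move=> /(congr1 par); rewrite par_even_row par_odd_row.
move=> hr; rewrite /bcol hr => /addnI [].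
move: hr; rewrite /brow; case: ltnP => hi; case: ltnP => hj // hr.
- exact: val_inj.
- by case: eo.
- by move=> h; apply: ord_inj; rewrite -(subnK hi) -[RHS](subnK hj) h.
Qed.

End Boxes.

(** * The principal W-algebra *)

Section WAlgebra.
Variables (F : fieldType) (par : parity_seq) (pi : pyramid).

Local Notation box := 'I_(nbox par pi).
Local Notation bp := (@bpar par pi).

Definition le_col : rel box := fun i j => (bcol i <= bcol j)%N.
Definition eq_col : rel box := fun i j => bcol i == bcol j.

(* U(g), U(p) and U(h) for g = gl_{m|n} *)
Local Notation Ug := (Ugl F bp (fun _ _ => true)).
Local Notation Up := (Ugl F bp le_col).
Local Notation Uh := (Ugl F bp eq_col).

Definition incl_gen (i j : box) : Ug := if le_col i j then ugen _ _ _ i j else 0.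

Lemma incl_rel : gl_rel bp le_col incl_gen.
Proof.
split=> [i j|i j k l ij kl]; rewrite /incl_gen; first by move/negbTE->.
rewrite ij kl; have [_ /(_ i j k l isT isT) ->] := ugen_rel F bp (fun _ _ => true).
congr (_ - _).
- case: eqP => [jk|]; last by rewrite !scale0r.
  by rewrite /le_col (leq_trans ij) ?jk.
- case: eqP => [il|]; last by rewrite mulr0 !scale0r.
  by rewrite /le_col (leq_trans kl) -?il.
Qed.

(* the natural map U(p) -> U(g), injective by the PBW theorem *)
Definition incl : {lrmorphism Up -> Ug} := ulift incl_rel.

Definition str (x : 'M[F]_(nbox par pi)) : F := \sum_i (-1) ^+ bp i * x i i.
Definition e_mx : 'M[F]_(nbox par pi) :=
  \matrix_(i, j) ((brow i == brow j) && (bcol j == (bcol i).+1))%:R.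
Definition chi (x : 'M[F]_(nbox par pi)) : F := str (x *m e_mx).

Definition of_mx (x : 'M[F]_(nbox par pi)) : Ug :=
  \sum_i \sum_j x i j *: ugen _ _ _ i j.

Definition in_m (x : 'M[F]_(nbox par pi)) : Prop :=
  forall i j, (bcol i <= bcol j)%N -> x i j = 0.

Definition m_chi : set Ug :=
  [set y | exists2 x, in_m x & y = of_mx x - (chi x)%:A]%classic.

(* m_chi U(g) *)
Inductive m_chiU : Ug -> Prop :=
  | m_chiU0 : m_chiU 0
  | m_chiUD y u v : m_chi y -> m_chiU v -> m_chiU (y * u + v).

Definition W_pred : {pred Up} :=
  fun u => `[< forall y, m_chi y -> m_chiU (incl u * y) >].

Lemma m_chiU_add u v : m_chiU u -> m_chiU v -> m_chiU (u + v).
Proof.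
by elim=> [|y w z hy _ ih] hv; rewrite ?add0r // -addrA; apply: m_chiUD => //; exact: ih.
Qed.

Lemma m_chiU_mulr u v : m_chiU u -> m_chiU (u * v).
Proof.
elim=> [|y w z hy _ ih]; first by rewrite mul0r; exact: m_chiU0.
by rewrite mulrDl -mulrA; exact: m_chiUD.
Qed.

Lemma W_closed : subalg_closed W_pred.
Proof.
split.
- apply/asboolP => y hy; rewrite rmorph1 mul1r -[y]mulr1 -[X in m_chiU X]addr0.
  by apply: m_chiUD => //; exact: m_chiU0.
- move=> c u v /asboolP hu /asboolP hv; apply/asboolP => y hy.
  rewrite linearP mulrDl; apply: m_chiU_add; last exact: hv.
  by rewrite -scalerAl -[X in c *: X]mulr1 scalerAr; apply: m_chiU_mulr; exact: hu.
- move=> u v /asboolP hu /asboolP hv; apply/asboolP => y hy.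
  rewrite rmorphM -mulrA; elim: (hv _ hy) => [|z w t hz _ ih].
    by rewrite mulr0; exact: m_chiU0.
  rewrite mulrDr mulrA; apply: m_chiU_add => //; apply: m_chiU_mulr; exact: hu.
Qed.

HB.instance Definition _ := GRing.isSubalgClosed.Build F Up W_pred W_closed.

Definition Wpi : algType F := subalg W_pred.

Definition Wgr (q : bool) (w : Wpi) : Prop := ugr q (val w).

(** Drinfeld generators *)

Definition prec (i j : box) : bool :=
  (bcol i < bcol j)%N || (bcol i == bcol j) && (brow i < brow j)%N.

Definition rho (j : box) : F :=
  (-1) ^+ bp j * (#|[set i | (prec i j || (i == j)) && bp i]|%:R -
                  #|[set i | prec i j && ~~ bp i]|%:R).

Definition shift_gen (c : F) (i j : box) : Up :=
  ugen _ _ _ i j + ((i == j)%:R * (c * rho i))%:A.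

Lemma prec_top i j : bcol i = bcol j -> brow i = row1 -> brow j = row2 ->
  forall x, prec x j = prec x i || (x == i).
Proof.
move=> cij ri rj x; rewrite /prec cij ri rj ltn0 andbF orbF.
have [->|xi] := eqVneq x i; first by rewrite ri cij eqxx orbT.
rewrite orbF; case: eqP => [xc|] /=; last by rewrite orbF.
rewrite orbC; case: (brow x =P row1) => [xr|].
  by case/eqP: xi; apply: box_inj; rewrite ?xr ?xc.
by case: (brow x) => -[|[|//]] h xr //; case: xr; apply: val_inj.
Qed.

Lemma rho_top i j : bcol i = bcol j -> brow i = row1 -> brow j = row2 ->
  rho i = - rho j.
Proof.
move=> cij ri rj; have pj := prec_top cij ri rj.
have nij : (i == j) = false by apply/eqP => ij; move: rj; rewrite -ij ri.
have pii : prec i i = false by rewrite /prec !ltnn andbF.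
have pjj : prec j j = false by rewrite /prec !ltnn andbF.
have pij : prec j i = false by rewrite /prec cij ri rj ltnn ltn0 andbF.
have bij : bp j = ~~ bp i.
  by have := rparP par; rewrite /bpar ri rj; case: (par _); case: (par _).
rewrite /rho bij; case E: (bp i) => /=.
- rewrite expr1 expr0 mulN1r mul1r; congr (- (_ - _)); congr (_%:R).
    apply: eq_card => x; rewrite !inE pj; case: (eqVneq x j) => [->|_].
      by rewrite bij E !andbF.
    by rewrite orbF.
  apply: eq_card => x; rewrite !inE pj; case: (eqVneq x i) => [->|_].
    by rewrite E !andbF.
  by rewrite orbF.
- rewrite expr0 expr1 mulN1r mul1r opprK.
  have -> : [set x | (prec x j || (x == j)) && bp x] =
      j |: [set x | (prec x i || (x == i)) && bp x].
    apply/setP=> x; rewrite !inE pj; case: (eqVneq x j) => [->|_] /=.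
      by rewrite bij E orbT.
    by rewrite orbF.
  have -> : [set x | prec x j && ~~ bp x] = i |: [set x | prec x i && ~~ bp x].
    apply/setP=> x; rewrite !inE pj; case: (eqVneq x i) => [->|_] /=.
      by rewrite E orbT.
    by rewrite orbF.
  rewrite !cardsU1 !inE pij pii eq_sym nij /=.
  by rewrite !natrD opprD addrACA subrr add0r.
Qed.

Lemma rho_col i j : bcol i = bcol j -> rho i = (-1) ^+ (bp i (+) bp j) * rho j.
Proof.
move=> cij.
have row12 (x : box) : brow x = row1 \/ brow x = row2.
  by case: (brow x) => -[|[|//]] h; [left|right]; apply: val_inj.
have odd12 a b : brow a = row1 -> brow b = row2 -> bp a (+) bp b = true.
  by have := rparP par; rewrite /bpar => + -> ->; case: (par _); case: (par _).
have [ri|ri] := row12 i; have [rj|rj] := row12 j.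
- by rewrite (box_inj (etrans ri (esym rj)) cij) addbb mul1r.
- by rewrite odd12 // expr1 mulN1r; exact: rho_top.
- by rewrite addbC odd12 // expr1 mulN1r (rho_top (esym cij) rj ri) opprK.
- by rewrite (box_inj (etrans ri (esym rj)) cij) addbb mul1r.
Qed.

Lemma shift_rel c : gl_rel bp le_col (shift_gen c).
Proof.
have [u0 ub] := ugen_rel F bp le_col; split=> [i j ij|i j k l ij kl].
  rewrite /shift_gen u0 //; case: eqP => [h|_]; last by rewrite mul0r scale0r addr0.
  by move: ij; rewrite h /le_col leqnn.
have shiftC (x y : Up) (a b e : F) : e = 1 \/ a = 0 /\ b = 0 ->
    (x + a%:A) * (y + b%:A) - e *: ((y + b%:A) * (x + a%:A)) =
    x * y - e *: (y * x).
  case=> [->|[-> ->]]; last by rewrite !scale0r !addr0.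
  have mulA2 (u v : Up) (f h : F) : (u + f%:A) * (v + h%:A) =
      u * v + (h *: u + f *: v + (f * h)%:A).
    by rewrite mulrDl !mulrDr !mulr_algl !mulr_algr scalerA !addrA.
  rewrite !scale1r !mulA2 [b * a]mulrC [a *: y + _]addrC.
  by rewrite opprD addrACA subrr addr0.
rewrite shiftC; last first.
  case: (eqVneq i j) => [->|_]; first by left; rewrite /brsgn addbb.
  case: (eqVneq k l) => [->|_]; first by left; rewrite /brsgn addbb andbF.
  by right; rewrite !mul0r.
rewrite (ub _ _ _ _ ij kl) /shift_gen !scalerDr !scalerA opprD addrACA.
rewrite -[LHS]addr0; congr (_ + _); rewrite -scalerBl.
case: (eqVneq j k) => [jk|_]; last first.
  by rewrite !(mul0r, mulr0) subrr scale0r.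
case: (eqVneq i l) => [il|_]; last by rewrite !(mul0r, mulr0) subrr scale0r.
have cij : bcol i = bcol j.
  apply/eqP; rewrite eqn_leq; apply/andP; split; first exact: ij.
  by rewrite jk il; exact: kl.
subst k l; rewrite !mul1r !mulr1 (rho_col cij) /brsgn [bp j (+) _]addbC andbb.
by rewrite mulrCA subrr scale0r.
Qed.

(* S_{rho} is [Sshift 1] and S_{-rho} is [Sshift (-1)] *)
Definition Sshift (c : F) : {lrmorphism Up -> Up} := ulift (shift_rel c).

Definition ebar (i j : box) : Up := (-1) ^+ bp i *: ugen _ _ _ i j.

(* Conditions on a family ((i_1, j_1), ..., (i_s, j_s)); [z] is varsigma, and
   row(j_a) <= varsigma reads [brow (w a).2 < z] as rows are counted from 0. *)
Definition t_index (i j : 'I_2) (z r s : nat) (w : {ffun 'I_s -> box * box}) : bool :=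
  [&& [forall a : 'I_s, (a == 0%N :> nat) ==> (brow (w a).1 == i)],
      [forall a : 'I_s, (a.+1 == s :> nat) ==> (brow (w a).2 == j)],
      [forall a, (bcol (w a).1 <= bcol (w a).2)%N],
      [forall a : 'I_s, forall b : 'I_s, (b == a.+1 :> nat) ==>
         (brow (w b).1 == brow (w a).2) &&
         (if (brow (w a).2 < z)%N then bcol (w b).1 <= bcol (w a).2
          else bcol (w a).2 < bcol (w b).1)%N] &
      (\sum_a (bcol (w a).2 - bcol (w a).1) == r - s)%N].

Definition t_gen (i j : 'I_2) (z r : nat) : Up :=
  Sshift 1 (\sum_(1 <= s < r.+1) (-1) ^+ (r - s) *:
    \sum_(w : {ffun 'I_s -> box * box} | t_index i j z r w)
      (-1) ^+ #|[set a : 'I_s | (a.+1 < s)%N && (brow (w a).2 < z)%N]| *: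
      \prod_(a < s) ebar (w a).1 (w a).2).

Definition d_gen (i : 'I_2) (r : nat) : Up :=
  if i == row1 then t_gen row1 row1 0 r else t_gen row2 row2 1 r.
Definition e_gen := t_gen row1 row2 1.
Definition f_gen := t_gen row2 row1 1.

(** Miura transform *)

Definition pr_gen (i j : box) : Uh := ugen _ _ _ i j.

Lemma pr_rel : gl_rel bp le_col pr_gen.
Proof.
have [u0 ub] := ugen_rel F bp eq_col; split=> [i j ij|i j k l ij kl].
  by apply: u0; apply: contra ij => /eqP; rewrite /le_col => ->.
have lt_out a b : le_col a b -> ~~ eq_col a b -> (bcol a < bcol b)%N.
  by rewrite /le_col /eq_col ltn_neqAle => -> ->.
have out a b : (bcol a < bcol b)%N -> pr_gen a b = 0.
  by move=> ab; apply: u0; rewrite /eq_col neq_ltn ab.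
have zero : (bcol i < bcol j)%N || (bcol k < bcol l)%N -> pr_gen i j * pr_gen k l = 0 /\
    pr_gen k l * pr_gen i j = 0.
  by case/orP=> h; rewrite (out _ _ h) !(mulr0, mul0r).
have [/andP[ijh klh]|] := boolP (eq_col i j && eq_col k l); first exact: ub.
rewrite negb_and => /orP h.
have {h} h : (bcol i < bcol j)%N || (bcol k < bcol l)%N.
  by apply/orP; case: h => [/(lt_out _ _ ij)|/(lt_out _ _ kl)]; [left|right].
have [-> ->] := zero h; rewrite scaler0 subrr.
have hil : j = k -> pr_gen i l = 0.
  move=> jk; apply: out; case/orP: h => h.
    by apply: leq_trans h _; rewrite jk.
  by apply: leq_ltn_trans ij _; rewrite jk.
have hkj : i = l -> pr_gen k j = 0.
  move=> il; apply: out; case/orP: h => h.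
    by apply: leq_ltn_trans kl _; rewrite -il.
  by apply: leq_trans h _; rewrite -il.
case: (eqVneq j k) => [/hil ->|_]; case: (eqVneq i l) => [/hkj ->|_];
  by rewrite ?(mulr0, scale0r, scaler0) subrr.
Qed.

Definition pr : {lrmorphism Up -> Uh} := ulift pr_rel.

Definition mu : {lrmorphism Wpi -> Uh} :=
  (pr \o (Sshift (-1) \o (subalg_val : subalg W_pred -> Up))).

Lemma mu_even q w : Wgr q w -> ugr q (mu w).
Proof.
move=> hw; apply: ulift_gr => [i j|]; first exact: ugr_gen.
apply: ulift_gr hw => i j; apply: ugrD; first exact: ugr_gen.
case: eqP => [->|_]; last by rewrite mul0r scale0r; exact: ugr0.
by rewrite addbb; apply: ugrZ; exact: ugr1.
Qed.

End WAlgebra.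

(** * Drinfeld presentation *)

Record drinfeld_rels (F : fieldType) (par : parity_seq) (pi : pyramid)
    (s : 'M[nat]_2) (B : algType F) (d : 'I_2 -> nat -> B) (e f : nat -> B) :
    Prop := DrinfeldRels {
  drel_d0 : forall i, d i 0%N = 1;
  drel_top : forall r, (top pi < r)%N -> d row1 r = 0;
  drel_dd : forall i j r t, (0 < r)%N -> (0 < t)%N ->
    d i r * d j t - d j t * d i r = 0;
  drel_ee : forall r t, (s row1 row2 < r)%N -> (s row1 row2 < t)%N ->
    e r * e t + e t * e r = 0;
  drel_ff : forall r t, (s row2 row1 < r)%N -> (s row2 row1 < t)%N ->
    f r * f t + f t * f r = 0;
  drel_ef : exists2 dt : nat -> B,
    (forall r, \sum_(0 <= a < r.+1) dt a * d row1 (r - a)%N = (r == 0)%:R) &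
    (forall r t, (s row1 row2 < r)%N -> (s row2 row1 < t)%N ->
      e r * f t + f t * e r = (-1) ^+ par row1 *:
        \sum_(0 <= a < r + t) dt a * d row2 (r + t - 1 - a)%N);
  drel_de : forall i r t, (0 < r)%N -> (s row1 row2 < t)%N ->
    d i r * e t - e t * d i r = (-1) ^+ par row1 *:
      \sum_(0 <= a < r) d i a * e (r + t - 1 - a)%N;
  drel_df : forall i r t, (0 < r)%N -> (s row2 row1 < t)%N ->
    d i r * f t - f t * d i r = - ((-1) ^+ par row1 *:
      \sum_(0 <= a < r) f (r + t - 1 - a)%N * d i a) }.

Section Representations.
Variables (F : fieldType) (par : parity_seq) (pi : pyramid) (s : 'M[nat]_2).

Local Notation W := (Wpi F par pi).
Local Notation gW := (@Wgr F par pi).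
Local Notation d_gen := (d_gen F par pi).
Local Notation e_gen := (e_gen F par pi).
Local Notation f_gen := (f_gen F par pi).

Definition drinfeld_agree (B : algType F) (phi : W -> B)
    (d : 'I_2 -> nat -> W) (e f : nat -> W)
    (d' : 'I_2 -> nat -> B) (e' f' : nat -> B) : Prop :=
  [/\ forall i r, (0 < r)%N -> phi (d i r) = d' i r,
      forall r, (s row1 row2 < r)%N -> phi (e r) = e' r &
      forall r, (s row2 row1 < r)%N -> phi (f r) = f' r].

(* The Drinfeld generators lie in W_pi and present it: [d], [e], [f] satisfy the
   relations and are universal for them.  The values of [e] and [f] outside the
   range of the generators are irrelevant. *)
Definition drinfeld_presentation : Prop :=
  exists (d : 'I_2 -> nat -> W) (e f : nat -> W),
  [/\ drinfeld_agree subalg_val d e f d_gen e_gen f_gen,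
      [/\ forall i r, (0 < r)%N -> gW false (d i r),
          forall r, (s row1 row2 < r)%N -> gW true (e r) &
          forall r, (s row2 row1 < r)%N -> gW true (f r)],
      drinfeld_rels par pi s d e f &
      forall (B : algType F) d' e' f', drinfeld_rels par pi s d' e' f' ->
        exists phi : {lrmorphism W -> B},
          drinfeld_agree phi d e f d' e' f' /\
          forall psi : {lrmorphism W -> B},
            drinfeld_agree psi d e f d' e' f' -> psi =1 phi].

Definition W0_set : set W :=
  galg_set [set w | exists i r, (0 < r <= rowlen pi i)%N /\
                      subalg_val w = d_gen i r]%classic.

Definition Wsharp_set : set W :=
  galg_set (W0_set `|` [set w | exists2 r,
    (s row1 row2 < r <= s row1 row2 + top pi)%N & subalg_val w = e_gen r])%classic.

Definition W0 : algType F := galg W0_set.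
Definition Wsharp : algType F := galg Wsharp_set.

Definition W0gr (q : bool) (w : W0) : Prop := gW q (subalg_val w).

(* The surjection of W_pi^sharp onto W_pi^0 *)
Definition is_sharp_proj (prj : {lrmorphism Wsharp -> W0}) : Prop :=
  (forall (w : W0) (x : Wsharp), subalg_val x = subalg_val w -> prj x = w) /\
  (forall (x : Wsharp) r, (s row1 row2 < r)%N ->
     subalg_val (subalg_val x) = e_gen r -> prj x = 0).

(** * Tableaux, Verma modules and their irreducible quotients *)

Record tableau := Tableau {
  trow1 : 'I_(top pi) -> F;
  trow2 : 'I_(bot pi) -> F }.

Definition row_equiv (A B : tableau) : Prop :=
  (exists g : {perm 'I_(top pi)}, forall i, trow1 B i = trow1 A (g i)) /\
  (exists g : {perm 'I_(bot pi)}, forall i, trow2 B i = trow2 A (g i)).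

Lemma topcol_subproof (i : 'I_(top pi)) : (off pi + i < bot pi)%N.
Proof. by apply: leq_trans (pyramidP pi); rewrite ltn_add2l. Qed.

(* column of the i-th box of the first row, counted from 0 *)
Definition topcol (i : 'I_(top pi)) : 'I_(bot pi) := Ordinal (topcol_subproof i).

Definition esym_val (n : nat) (a : 'I_n -> F) (r : nat) : F :=
  \sum_(S : {set 'I_n} | #|S| == r) \prod_(i in S) a i.

(* [v] is the basis vector 1_A of [C] = C_A *)
Definition is_CA (A : tableau) (C : supermod W0gr) (v : C) : Prop :=
  [/\ smod_gr false v,
      v <> 0 /\ (forall u : C, exists c, u = c *: v),
      (forall (w : W0) r, (0 < r <= top pi)%N ->
         subalg_val (subalg_val w) = d_gen row1 r ->
         smod_act w v = esym_val (trow1 A) r *: v) &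
      (forall (w : W0) r, (0 < r <= bot pi)%N ->
         subalg_val (subalg_val w) = d_gen row2 r ->
         smod_act w v = esym_val (trow2 A) r *: v)].

Definition balanced (prj : {lrmorphism Wsharp -> W0}) (C : supermod W0gr)
    (X : lmodType F) (t : W -> C -> X) : Prop :=
  [/\ forall u, linear (t^~ u), forall w, linear (t w) &
      forall w (x : Wsharp) u,
        t (w * subalg_val x) u = t w (smod_act (prj x) u)].

(* [M] is the tensor product of [W] and [C] over W_pi^sharp, with universal
   balanced map [t]; W_pi^sharp acts on [C] through [prj]. *)
Record is_tensor (prj : {lrmorphism Wsharp -> W0}) (C : supermod W0gr)
    (M : supermod gW) (t : W -> C -> M) : Prop := IsTensor {
  tens_bal : balanced prj t;
  tens_act : forall w w' u, smod_act w (t w' u) = t (w * w') u;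
  tens_gr : forall q r w u, gW q w -> smod_gr r u -> smod_gr (q (+) r) (t w u);
  tens_univ : forall (X : lmodType F) (b : W -> C -> X), balanced prj b ->
    exists2 g : {linear M -> X}, (forall w u, g (t w u) = b w u) &
      forall g' : {linear M -> X}, (forall w u, g' (t w u) = b w u) -> g' =1 g }.

Definition is_Mbar (A : tableau) (M : supermod gW) : Prop :=
  exists (prj : {lrmorphism Wsharp -> W0}) (C : supermod W0gr) (v : C)
         (t : W -> C -> M),
    [/\ is_sharp_proj prj, is_CA A v & is_tensor prj t].

Definition is_Lbar (A : tableau) (L : supermod gW) : Prop :=
  exists2 M, is_Mbar A M & unique_irreducible_quotient M L.

(** * Standard modules *)

Definition has_box (r : 'I_2) (c : 'I_(bot pi)) : bool :=
  [exists i : 'I_(nbox par pi), (brow i == r) && (bcol i == c.+1)].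

Definition in_column (c : 'I_(bot pi)) : rel 'I_2 :=
  fun r r' => has_box r c && has_box r' c.

(* U_c is the enveloping superalgebra of the span of the e_{r,r'} with [r], [r']
   rows of column c: gl_{1|1} if the column has two boxes, and gl_1 if it has
   one, with basis written e_{2,2} instead of e_{1,1}. *)
Local Notation colmod c := (supermod (@ugr F _ par (in_column c))).
Local Notation hmod :=
  (supermod (@ugr F _ (@bpar par pi) (@eq_col par pi))).

Definition is_Lcol (A : tableau) (c : 'I_(bot pi)) (L : colmod c) : Prop :=
  exists v : L,
  [/\ smod_gr false v,
      smod_act (ugen _ _ _ row2 row2) v = ((-1) ^+ par row2 * trow2 A c) *: v &
      match [pick i | topcol i == c] with
      | Some i =>
        [/\ irreducible L,
            forall u : L, exists x, u = smod_act x v,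
            smod_act (ugen _ _ _ row1 row1) v =
              ((-1) ^+ par row1 * trow1 A i) *: v &
            smod_act (ugen _ _ _ row1 row2) v = 0]
      | None => v <> 0 /\ forall u : L, exists a, u = a *: v
      end].

Definition multilinear (T : 'I_(bot pi) -> lmodType F) (X : lmodType F)
    (t : (forall c, T c) -> X) : Prop :=
  forall (v : forall c, T c) c, linear (fun x : T c => t (dfwith v x)).

(* [X] is the outer tensor product of the [Lc], with universal multilinear map
   [t]; e_{i,j} in column c acts on the c-th factor. *)
Record is_outer_tensor (Lc : forall c, colmod c) (X : hmod)
    (t : (forall c, Lc c) -> X) : Prop := IsOuterTensor {
  otens_lin : multilinear t;
  otens_gr : forall (q : 'I_(bot pi) -> bool) (v : forall c, Lc c),
    (forall c, smod_gr (q c) (v c)) ->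
    smod_gr (\big[addb/false]_c q c) (t v);
  otens_act : forall (i j : 'I_(nbox par pi)) (c : 'I_(bot pi))
      (q : 'I_(bot pi) -> bool) (v : forall c, Lc c),
    bcol i = c.+1 -> bcol j = c.+1 -> (forall c', smod_gr (q c') (v c')) ->
    smod_act (ugen _ _ _ i j) (t v) =
      (-1) ^+ ((bpar i (+) bpar j) &&
               \big[addb/false]_(c' < bot pi | (c' < c)%N) q c') *:
      t (dfwith v (smod_act (ugen _ _ _ (brow i) (brow j)) (v c)));
  otens_univ : forall (Y : lmodType F) (b : (forall c, Lc c) -> Y),
    multilinear b ->
    exists2 g : {linear X -> Y}, (forall v, g (t v) = b v) &
      forall g' : {linear X -> Y}, (forall v, g' (t v) = b v) -> g' =1 g }.

(* [X] is the U(h)-supermodule L(A_1) (x) ... (x) L(A_l) *)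
Definition is_outer_V (A : tableau) (X : hmod) : Prop :=
  exists (Lc : forall c, colmod c) (t : (forall c, Lc c) -> X),
    (forall c, is_Lcol A (Lc c)) /\ is_outer_tensor t.

Definition is_Vbar (A : tableau) (V : supermod gW) : Prop :=
  exists2 X : hmod, is_outer_V A X & V = pullback (@mu_even F par pi) X.

Definition matching (A : tableau) (h : nat) : Prop :=
  exists (i : 'I_h -> 'I_(top pi)) (j : 'I_h -> 'I_(bot pi)),
    [/\ injective i, injective j & forall x, trow1 A (i x) = trow2 A (j x)].

Definition max_matching (A : tableau) (h : nat) : Prop :=
  matching A h /\ forall h', matching A h' -> (h' <= h)%N.

Definition equal_columns (A : tableau) : nat :=
  #|[set i : 'I_(top pi) | trow1 A i == trow2 A (topcol i)]|.

End Representations.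

(* Main.v *)
Require Import Defs.
From HB Require Import structures.
From mathcomp Require Import all_boot all_algebra perm.
From mathcomp Require Import reals complex.
From mathcomp Require Import boolp classical_sets.
From mathcomp Require Import zify ring.

(** On a highest weight vector, W_pi acts through a Clifford algebra. Put
    c(u) = d_1(u)^-1 d_2(u). The Drinfeld relations imply that the coefficients of
    c(u) are central ([ratio_comm_e], [ratio_comm_f]), and that the anticommutator
    of e^(r) and f^(t) is, up to a sign, the coefficient of index r + t - 1. Let w0 be
    killed by all e^(r), and let d_1 and d_2 act on it by the elementary symmetric
    polynomials of the entries a_i and b_j of the tableau. On the module generated by
    w0, c(u) is then the expansion of the product of the u + b_j divided by that of
    the u + a_i, up to a power of u, and the anticommutators of the e and the f form
    a Hankel matrix of this rational function. The equal columns of B cancel h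
    factors, and maximality of h says that the remaining fraction Q/P is in lowest
    terms, with P of degree n = k - h. An inverse of Q modulo P gives combinations
    E_i of the e and F_j of the f, for 0 <= i, j < n, with triangular anticommutators
    ([coef_modp_shift], [hankel_dual]).

    Such operators produce 2^n independent vectors from any vector killed by the
    E_i ([fock_inj]), and every nonzero submodule contains a nonzero vector of this
    kind ([exists_vacuum]). A module that contains w0 and is spanned by 2^n vectors
    is therefore irreducible of dimension 2^n and generated by w0
    ([highest_weight_irreducible]).

    The standard module of B satisfies these hypotheses. A column with equal entries
    contributes a one-dimensional factor, so 2^n vectors span the tensor product
    ([outer_V_highest]). The Miura transform computes the action of the Drinfeld
    generators on the tensor product of the highest weight vectors of the columns,
    with the eigenvalues required for A, as A and B have the same rows up to order
    ([mu_e], [mu_d_row]). Finally the Verma module of A maps onto this module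
    ([verma_map]), so it is the irreducible quotient of the Verma module. *)

Set Implicit Arguments.
Unset Strict Implicit.
Unset Printing Implicit Defensive.

Import GRing.Theory.
(* [row1] and [row2] denote the rows of a pyramid, not the matrix lemmas. *)
Import Defs.

Local Open Scope ring_scope.
Local Open Scope complex_scope.

(** * Clifford operators on a vector space *)

(** Lifting [Phi] through [Psi] on the standard basis gives a square matrix; it is
    injective because [Phi] is, hence invertible. *)
Lemma linear_surj_of_inj (F : fieldType) (V : lmodType F) (d d' : nat)
    (Phi : {linear 'rV[F]_d -> V}) (Psi : {linear 'rV[F]_d' -> V}) :
  d = d' -> (forall r, Phi r = 0 -> r = 0) -> (forall v, exists r, Psi r = v) ->
  forall v, exists r, Phi r = v.
Proof.
move=> dd'; case: _ / dd' Psi => Psi inj surj v.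
pose M : 'M[F]_d := \matrix_i sval (cid (surj (Phi (delta_mx 0 i)))).
have PhiE r : Phi r = Psi (r *m M).
  rewrite mulmx_sum_row {1}[r]row_sum_delta !linear_sum /=.
  apply: eq_bigr => i _; rewrite !linearZ /= rowK.
  by case: cid => /= x ->.
have Mu : M \in unitmx.
  rewrite -row_free_unit -kermx_eq0; apply/eqP/row_matrixP => i.
  rewrite row0; apply: inj; rewrite PhiE -row_mul mulmx_ker row0.
  exact: linear0.
have [y <-] := surj v.
by exists (y *m invmx M); rewrite PhiE mulmxKV.
Qed.

(** The submodule generated by a vacuum vector. Operators [E i] killing [x0] and
    creation operators [G j] are only assumed to satisfy the Clifford relations
    for [j <= i], which is what a triangular choice of [E i] and [G j] provides, and
    only on a subspace [U], since the anticommutators are scalars at first only on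
    the submodule generated by one vector. *)
Section Fock.
Variables (F : fieldType) (V : lmodType F) (n : nat).
Variables (E G : nat -> {linear V -> V}) (U : V -> Prop) (x0 : V).
Hypothesis UZ : forall c u v, U u -> U v -> U (c *: u + v).
Hypothesis UG : forall j u, U u -> U (G j u).
Hypothesis Ux0 : U x0.
Hypothesis x0n0 : x0 <> 0.
Hypothesis Ex0 : forall i, (i < n)%N -> E i x0 = 0.
Hypothesis EG : forall i j u, (j <= i < n)%N -> U u ->
  E i (G j u) = (i == j)%:R *: u - G j (E i u).

Fixpoint fdim m := if m is p.+1 then (fdim p + fdim p)%N else 1%N.

Lemma fdimE m : fdim m = (2 ^ m)%N.
Proof. by elim: m => //= m ->; rewrite addnn expnS mul2n. Qed.

(** [fock m r] is the combination with coefficients [r] of the [2 ^ m] ordered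
    products of [G 0], ..., [G m.-1] applied to [x0]: the second half of [r]
    gathers the products that start with [G m.-1]. *)
Fixpoint fock m : 'rV[F]_(fdim m) -> V :=
  if m is p.+1 then
    fun r : 'rV[F]_(fdim p + fdim p) => fock (lsubmx r) + G p (fock (rsubmx r))
  else fun r : 'rV[F]_1 => r 0 0 *: x0.

Lemma fock_linear m : linear (@fock m).
Proof.
elim: m => [|m IH] c u v /=; first by rewrite !mxE scalerDl scalerA.
by rewrite !linearP /= !IH linearP scalerDr addrACA.
Qed.
HB.instance Definition _ m :=
  GRing.isLinear.Build F 'rV[F]_(fdim m) V *:%R (@fock m) (@fock_linear m).

Lemma fock_in m r : U (@fock m r).
Proof.
elim: m r => [|m IH] r /=.
  have U0 : U 0 by have := UZ (-1) Ux0 Ux0; rewrite scaleN1r addNr.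
  by rewrite -[_ *: _]addr0; apply: UZ.
by rewrite addrC -[G _ _]scale1r; apply: UZ (IH _); apply: UG; exact: IH.
Qed.

Lemma fock_kill m r i : (m <= i < n)%N -> E i (@fock m r) = 0.
Proof.
elim: m r => [|m IH] r /andP[mi iN] /=; first by rewrite linearZ /= Ex0 ?scaler0.
rewrite linearD /= IH ?(ltnW mi) // EG ?(ltnW mi) //; last exact: fock_in.
by rewrite IH ?(ltnW mi) // linear0 subr0 gtn_eqF // scale0r addr0.
Qed.

(** Applying [E m] to [fock m.+1 r] isolates the second half of [r], because
    [E m] kills [fock m]; the first half then vanishes in turn. *)
Lemma fock_inj m r : (m <= n)%N -> @fock m r = 0 -> r = 0.
Proof.
elim: m r => [|m IH] r mn /=.
  move=> /eqP; rewrite scaler_eq0 => /orP[/eqP r0|/eqP //].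
  by apply/rowP => i; rewrite !ord1 r0 mxE.
move=> r0; have := congr1 (E m) r0.
rewrite linearD /= fock_kill ?leqnn // EG ?leqnn //; last exact: fock_in.
rewrite fock_kill ?leqnn // eqxx scale1r linear0 subr0 add0r linear0.
move=> /(IH _ (ltnW mn)) rr; move: r0; rewrite rr linear0 linear0 addr0.
move=> /(IH _ (ltnW mn)) rl.
by rewrite -[r]hsubmxK rl rr row_mx0.
Qed.

Lemma fock_surj d (Psi : {linear 'rV[F]_d -> V}) : d = (2 ^ n)%N ->
  (forall v, exists r, Psi r = v) -> forall v, exists r, @fock n r = v.
Proof.
move=> dn; apply: linear_surj_of_inj; first by rewrite fdimE dn.
by move=> r; exact: fock_inj.
Qed.

End Fock.

(** Since the [E i] square to zero and anticommute, replacing [x] by [E i x]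
    whenever this is nonzero, for each [i] in turn, ends in the common kernel. *)
Lemma exists_vacuum (F : fieldType) (V : lmodType F) (n : nat)
    (E : nat -> {linear V -> V}) (N : V -> Prop) (x : V) :
  (forall i j u, E i (E j u) = - E j (E i u)) -> (forall i u, E i (E i u) = 0) ->
  (forall i u, N u -> N (E i u)) -> N x -> x <> 0 ->
  exists y, [/\ N y, y <> 0 & forall i, (i < n)%N -> E i y = 0].
Proof.
move=> anti sq NE Nx xn0; elim: n => [|n [y [Ny yn0 ky]]]; first by exists x.
have [Ey|Ey] := eqVneq (E n y) 0.
  exists y; split=> // i; rewrite ltnS leq_eqVlt => /orP[/eqP ->//|]; exact: ky.
exists (E n y); split; [exact: NE|exact/eqP|move=> i].
rewrite ltnS leq_eqVlt => /orP[/eqP ->|/ky iy]; first exact: sq.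
by rewrite anti iy linear0 oppr0.
Qed.

(** * Hankel pairings of rational functions *)

Section Hankel.
Variable F : fieldType.

(** The recurrence says that [g] is the power series [q / p] in the inverse of the
    variable. Up to a shift by [d], the part of [QB / PA] of negative degree is that
    of [g], and the leading coefficients of the remainders of [QB * 'X^m] read off
    its coefficients one by one. *)
Lemma coef_modp_shift (k d : nat) (p g q : nat -> F) (PA QB : {poly F}) :
  p 0%N = 1 -> (forall a, (k < a)%N -> p a = 0) ->
  (forall m, (k + d < m)%N -> q m = 0) ->
  (forall m, \sum_(a < m.+1) p a * g (m - a)%N = q m) ->
  PA = \poly_(t < k.+1) p (k - t)%N ->
  QB = \poly_(t < (k + d).+1) q (k + d - t)%N ->
  (0 < k)%N ->
  forall m, (QB * 'X^m %% PA)`_k.-1 = g (d + m).+1.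
Proof.
move=> p0 pk qk pg PAE QBE k0 m.
(* [C] is the polynomial part of [QB * 'X^m / PA]. *)
pose N := (d + m)%N; pose C : {poly F} := \poly_(t < N.+1) g (N - t)%N.
have PAk : PA`_k = 1 by rewrite PAE coef_poly ltnS leqnn subnn p0.
have szPA : size PA = k.+1.
  apply/eqP; rewrite eqn_leq {1}PAE size_poly /= ltnNge; apply/negP => h.
  by have := oner_eq0 F; rewrite -PAk nth_default ?eqxx.
have PAr : PA = \sum_(a < k.+1) p a *: 'X^(k - a).
  rewrite PAE poly_def (reindex_inj rev_ord_inj) /=.
  by apply: eq_bigr => a _; rewrite subSS subKn // -ltnS.
have coefPC j : (j <= N + k)%N -> (PA * C)`_(N + k - j) =
    \sum_(a < j.+1) if (j - a <= N)%N then p a * g (j - a)%N else 0.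
  move=> jN; rewrite PAr mulr_suml coef_sum.
  rewrite (big_ord_widen (k + j).+1 (fun a => (p a *: 'X^(k - a) * C)`_(N + k - j)));
    last by lia.
  rewrite (big_ord_widen (k + j).+1
    (fun a => if (j - a <= N)%N then p a * g (j - a)%N else 0)); last by lia.
  rewrite big_mkcond [RHS]big_mkcond; apply: eq_bigr => a _.
  rewrite -scalerAl coefZ -commr_polyXn coefMXn coef_poly !ltnS.
  case: (leqP a k) => ak; last by rewrite (pk _ ak) !mul0r !if_same.
  have -> : (N + k - j < k - a)%N = (N < j - a)%N by lia.
  case: (leqP (j - a) N) => h; last by rewrite mulr0 ?if_same.
  have -> : (N + k - j - (k - a) <= N)%N = (a <= j)%N by lia.
  case: (leqP a j) => aj; last by rewrite mulr0.
  by congr (_ * g _); lia.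
pose R : {poly F} := QB * 'X^m - PA * C.
have coefQ j : (j <= N + k)%N -> (QB * 'X^m)`_(N + k - j) = q j.
  move=> jN; rewrite coefMXn QBE coef_poly ltnS.
  have [h|h] := ltnP (N + k - j) m.
    by rewrite qk //; rewrite /N in h jN; lia.
  have -> : (N + k - j - m <= k + d)%N by rewrite /N; lia.
  by congr q; rewrite /N in h jN *; lia.
have szR : (size R < size PA)%N.
  rewrite szPA ltnS; apply/leq_sizeP => t kt.
  have [tN|tN] := leqP t (N + k); last first.
    rewrite nth_default //; apply: leq_trans (size_polyD _ _) _.
    rewrite size_polyN geq_max; apply/andP; split.
      apply: leq_trans (size_polyMleq _ _) _; rewrite size_polyXn.
      have : (size QB <= (k + d).+1)%N by rewrite QBE; exact: size_poly.
      by rewrite /N in tN; lia.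
    apply: leq_trans (size_polyMleq _ _) _.
    have szC : (size C <= N.+1)%N by exact: size_poly.
    rewrite szPA addSn /=; apply: leq_trans (leq_add (leqnn k) szC) _.
    by rewrite addnS addnC.
  have -> : t = (N + k - (N + k - t))%N by rewrite subKn.
  rewrite coefB coefQ ?coefPC ?leq_subr // -pg.
  apply/eqP; rewrite subr_eq0; apply/eqP/eq_bigr => a _.
  by case: ifP => //; lia.
have -> : QB * 'X^m = C * PA + R by rewrite /R [C * _]mulrC addrC subrK.
rewrite modpD modp_mull add0r modp_small //.
have e1 : k.-1 = (N + k - N.+1)%N by lia.
rewrite /R e1 coefB coefQ; last by lia.
rewrite coefPC; last by lia.
rewrite -pg big_ord_recl [X in _ - X]big_ord_recl /= !subn0 ltnn p0 add0r mul1r.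
rewrite -addrA -[RHS]addr0; congr (_ + _); apply/eqP; rewrite subr_eq0.
apply/eqP/eq_bigr => a _; rewrite /bump /=.
by case: ifP => //; lia.
Qed.

(** With [Q'] inverse to [Q] modulo [P], the functional that takes the top
    coefficient modulo [P * G] sends [Q * G * Q' * 'X^t] to the top coefficient of
    ['X^t] modulo [P], which is [0] for [t < n.-1] and [1] for [t = n.-1]. *)
Lemma hankel_dual (n : nat) (P Q Q' G : {poly F}) :
  P \is monic -> G \is monic -> size P = n.+1 -> P %| Q * Q' - 1 ->
  forall i j, (j <= i < n)%N ->
  ((Q * G) * (Q' * 'X^(n.-1 - i) * 'X^j) %% (P * G))`_(size (P * G)).-2 =
    (i == j)%:R.
Proof.
move=> Pm Gm szP QQ' i j /andP[ji iN].
have Pn0 := monic_neq0 Pm; have Gn0 := monic_neq0 Gm.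
have -> : Q * G * (Q' * 'X^(n.-1 - i) * 'X^j) =
    (Q * Q' * 'X^(n.-1 - i + j)) * G by rewrite exprD; ring.
have szX : (size ('X^(n.-1 - i + j) : {poly F}) < size P)%N.
  by rewrite size_polyXn szP; lia.
have -> : Q * Q' * 'X^(n.-1 - i + j) * G %% (P * G) = 'X^(n.-1 - i + j) * G.
  have /dvdpP [H HE] := QQ'.
  have -> : Q * Q' = H * P + 1 by rewrite -HE subrK.
  have -> : (H * P + 1) * 'X^(n.-1 - i + j) * G =
     (H * 'X^(n.-1 - i + j)) * (P * G) + 'X^(n.-1 - i + j) * G by ring.
  rewrite modpD modp_mull add0r modp_small // !size_mul ?monic_neq0 ?monicXn //.
  have : (0 < size G)%N by rewrite size_poly_gt0.
  by case: (size G) => // c _; rewrite !addnS /= ltn_add2r.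
rewrite size_monicM // -commr_polyXn coefMXn szP.
have szG : (0 < size G)%N by rewrite size_poly_gt0.
have [->|ij] := eqVneq i j.
  rewrite subnK; last by lia.
  rewrite ifF; last by lia.
  by rewrite -(monicP Gm) lead_coefE; congr (_`_ _); lia.
rewrite ifF; last by lia.
apply: nth_default; move: (size G) szG => c c0.
by move: ji iN ij; rewrite eqn_leq; lia.
Qed.
End Hankel.

(** * Central elements from the Drinfeld relations *)

Section Convolution.
Variable B : nzRingType.
Implicit Types x y z : nat -> B.

Definition conv x y (m : nat) : B := \sum_(a < m.+1) x a * y (m - a)%N.

Lemma eq_conv x x' y y' m : (forall a, (a <= m)%N -> x a = x' a) ->
  (forall a, (a <= m)%N -> y a = y' a) -> conv x y m = conv x' y' m.
Proof.
move=> hx hy; apply: eq_bigr => a _; rewrite hx ?hy ?leq_subr //.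
by rewrite -ltnS.
Qed.

Lemma conv_coef K x y m : (m < K)%N ->
  conv x y m = (\poly_(i < K) x i * \poly_(i < K) y i)`_m.
Proof.
move=> mK; rewrite coefM; apply: eq_bigr => a _.
have aK : (a < K)%N by apply: leq_trans mK; exact: ltn_ord.
by rewrite !coef_poly aK (leq_ltn_trans (leq_subr _ _) mK).
Qed.

(** Convolution is the product of power series, so it suffices to multiply
    truncated series as polynomials. *)
Lemma convA x y z m : conv x (conv y z) m = conv (conv x y) z m.
Proof.
pose p (w : nat -> B) := \poly_(i < m.+1) w i.
transitivity ((p x * (p y * p z))`_m).
  rewrite coefM; apply: eq_bigr => a _.
  by rewrite coef_poly ltn_ord -conv_coef // ltnS leq_subr.
rewrite mulrA coefM; apply: eq_bigr => a _.
by rewrite -conv_coef // coef_poly ltnS leq_subr.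
Qed.

Lemma conv_rev x y m : conv x y m = \sum_(a < m.+1) x (m - a)%N * y a.
Proof.
rewrite /conv (reindex_inj rev_ord_inj); apply: eq_bigr => a _ /=.
by rewrite subSS subKn // -ltnS.
Qed.

(** In terms of series, [d1] and [d2] both satisfy [d x - x d = +- d eta] with
    the same [eta]. Expanding this for [d2 = d1 c] gives [d1 (c x - x c) = 0]
    provided [eta] commutes with [c]; as [eta] has no constant term, the
    coefficient of degree [m] only needs this commutation in degrees below [m]. *)
Lemma ratio_comm (b : bool) (s0 : nat) (d1 d2 c x : nat -> B) :
  d1 0%N = 1 -> (forall m, conv d1 c m = d2 m) ->
  (forall r t, (s0 < t)%N -> d1 r * x t - x t * d1 r =
     (-1) ^+ b * \sum_(a < r) d1 a * x (r + t - 1 - a)%N) ->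
  (forall r t, (s0 < t)%N -> d2 r * x t - x t * d2 r =
     (-1) ^+ b * \sum_(a < r) d2 a * x (r + t - 1 - a)%N) ->
  forall m t, (s0 < t)%N -> c m * x t = x t * c m.
Proof.
move=> d10 d1c hd1 hd2 m; elim/ltn_ind: m => m IH t st.
pose eta j := if j is i.+1 then x (i + t)%N else 0.
have sumE (w : nat -> B) r : \sum_(a < r) w a * x (r + t - 1 - a)%N = conv w eta r.
  rewrite /conv big_ord_recr /= subnn mulr0 addr0; apply: eq_bigr => a _.
  rewrite -(subnSK (ltn_ord a)) /=; congr (_ * x _).
  by have := ltn_ord a; lia.
have etac j : (j <= m)%N -> conv eta c j = conv c eta j.
  move=> jm; rewrite conv_rev; apply: eq_bigr => a _.
  case E: (j - a)%N => [|i] /=; first by rewrite mul0r mulr0.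
  by rewrite -IH //; lia.
have key : \sum_(a < m.+1) d1 a * (c (m - a)%N * x t - x t * c (m - a)%N) = 0.
  have -> : \sum_(a < m.+1) d1 a * (c (m - a)%N * x t - x t * c (m - a)%N) =
    (conv d1 c m * x t - x t * conv d1 c m) -
     \sum_(a < m.+1) (d1 a * x t - x t * d1 a) * c (m - a)%N.
    rewrite mulr_suml mulr_sumr -!sumrB; apply: eq_bigr => a _.
    by rewrite mulrBr mulrBl !mulrA opprB addrA addrNK.
  rewrite !d1c hd2 // sumE.
  have -> : \sum_(a < m.+1) (d1 a * x t - x t * d1 a) * c (m - a)%N =
      (-1) ^+ b * conv (conv d1 eta) c m.
    rewrite mulr_sumr; apply: eq_bigr => a _; rewrite hd1 // sumE.
    by rewrite -mulrA.
  rewrite -mulrBr -convA (@eq_conv d1 d1 (conv eta c) (conv c eta)) // convA.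
  by rewrite (@eq_conv (conv d1 c) d2 eta eta) // subrr mulr0.
move: key; rewrite big_ord_recl /= d10 mul1r subn0 big1 ?addr0.
  by move/eqP; rewrite subr_eq0 => /eqP.
move=> a _; rewrite IH ?subrr ?mulr0 //.
by rewrite /bump /=; have := ltn_ord a; lia.
Qed.
End Convolution.

Section DrinfeldCenter.
Variables (F : fieldType) (par : parity_seq) (pi : pyramid) (s : 'M[nat]_2).
Variables (B : algType F) (d : 'I_2 -> nat -> B) (e f : nat -> B).
Hypothesis rels : drinfeld_rels par pi s d e f.
Variable dt : nat -> B.
Hypothesis dtE : forall r, \sum_(0 <= a < r.+1) dt a * d row1 (r - a)%N = (r == 0)%:R.

(** The coefficients of the series [d_1(u)^-1 d_2(u)]. *)
Definition ratio m : B := conv dt (d row2) m.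

Lemma d_comm i j r t : d i r * d j t = d j t * d i r.
Proof.
case: r => [|r]; first by rewrite (drel_d0 rels) mul1r mulr1.
case: t => [|t]; first by rewrite (drel_d0 rels) mul1r mulr1.
by apply/eqP; rewrite -subr_eq0; apply/eqP; exact: (drel_dd rels).
Qed.

Lemma dt_rec r : dt r = (r == 0)%:R - \sum_(0 <= a < r) dt a * d row1 (r - a)%N.
Proof.
rewrite -dtE big_nat_recr //= subnn (drel_d0 rels) mulr1.
by rewrite addrAC subrr add0r.
Qed.

Lemma dt_comm j r t : dt r * d j t = d j t * dt r.
Proof.
elim/ltn_ind: r => r IH; rewrite dt_rec mulrBl mulrBr mulr_suml mulr_sumr.
congr (_ - _); first by case: (r == 0); rewrite ?mul1r ?mulr1 ?mul0r ?mulr0.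
rewrite !big_mkord; apply: eq_bigr => a _.
by rewrite -mulrA (d_comm row1 j) !mulrA IH.
Qed.

Lemma ratio_comm_d m j t : ratio m * d j t = d j t * ratio m.
Proof.
rewrite mulr_suml mulr_sumr; apply: eq_bigr => a _.
by rewrite -mulrA (d_comm row2 j) !mulrA dt_comm.
Qed.

Lemma d1_ratio m : conv (d row1) ratio m = d row2 m.
Proof.
rewrite /ratio convA /conv big_ord_recl /=.
have one a : conv (d row1) dt a = (a == 0)%:R.
  by rewrite -dtE big_mkord conv_rev; apply: eq_bigr => i _; rewrite dt_comm.
rewrite [X in X * _]one mul1r subn0 big1 ?addr0 // => i _.
by rewrite [X in X * _]one mul0r.
Qed.

Lemma ratio_d1 m : conv ratio (d row1) m = d row2 m.
Proof.
rewrite -d1_ratio conv_rev; apply: eq_bigr => a _; exact: ratio_comm_d.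
Qed.

Lemma ratio_comm_e m t : (s row1 row2 < t)%N -> ratio m * e t = e t * ratio m.
Proof.
apply: (ratio_comm (b := par row1) (drel_d0 rels row1) d1_ratio) => r u su;
 (case: r => [|r]; first by
    rewrite (drel_d0 rels) mul1r mulr1 subrr big_ord0 mulr0);
 by rewrite (drel_de rels) // scaler_sign mulr_sign big_mkord.
Qed.

(** In the opposite algebra, the relation between [d] and [f] takes the form of
    the relation between [d] and [e]. *)
Lemma ratio_comm_f m t : (s row2 row1 < t)%N -> ratio m * f t = f t * ratio m.
Proof.
move=> st; symmetry.
apply: (@ratio_comm B^c (par row1) _ (d row1) (d row2)) st => [|k|r u su|r u su].
- exact: (drel_d0 rels row1).
- by rewrite -ratio_d1 conv_rev.
- case: r => [|r]; first by rewrite (drel_d0 rels) mul1r mulr1 subrr big_ord0 mulr0.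
  rewrite mulr_sign /=.
  have := drel_df rels row1 (isT : 0 < r.+1)%N su.
  move/(congr1 -%R); rewrite opprB opprK => ->.
  by rewrite scaler_sign big_mkord.
- case: r => [|r]; first by rewrite (drel_d0 rels) mul1r mulr1 subrr big_ord0 mulr0.
  rewrite mulr_sign /=.
  have := drel_df rels row2 (isT : 0 < r.+1)%N su.
  move/(congr1 -%R); rewrite opprB opprK => ->.
  by rewrite scaler_sign big_mkord.
Qed.
End DrinfeldCenter.

(** * Supermodules, and generation of W_pi *)

Section SupermoduleTheory.
Variables (F : fieldType) (A : algType F) (gA : bool -> A -> Prop).
Implicit Types V : supermod gA.

Section Action.
Variable V : supermod gA.

Lemma smod_act_linear a : linear (@smod_act _ _ _ V a).
Proof. exact: (smod_actr (smodP V) a). Qed.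
HB.instance Definition _ (a : A) :=
  GRing.isLinear.Build F V V *:%R (@smod_act _ _ _ V a) (smod_act_linear a).

Lemma smodDl (a b : A) (v : V) : smod_act (a + b) v = smod_act a v + smod_act b v.
Proof. by have := smod_actl (smodP V) v 1 a b; rewrite !scale1r. Qed.

Lemma smodZl c (a : A) (v : V) : smod_act (c *: a) v = c *: smod_act a v.
Proof.
have z : smod_act 0 v = 0.
  have := smod_actl (smodP V) v 1 0 0; rewrite !scale1r addr0.
  by move=> /(congr1 (+%R (- smod_act 0 v))); rewrite addNr addKr.
by have := smod_actl (smodP V) v c a 0; rewrite z !addr0.
Qed.

Lemma smod0l (v : V) : smod_act 0 v = 0.
Proof. by have := smodZl 0 0 v; rewrite !scale0r. Qed.

Lemma smodNl (a : A) (v : V) : smod_act (- a) v = - smod_act a v.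
Proof. by have := smodZl (-1) a v; rewrite !scaleN1r. Qed.

Lemma smod1 (v : V) : smod_act 1 v = v. Proof. exact: (smod_act1 (smodP V)). Qed.

Lemma smodM (a b : A) (v : V) : smod_act (a * b) v = smod_act a (smod_act b v).
Proof. exact: (smod_actM (smodP V)). Qed.

Lemma smod_suml (I : Type) (r : seq I) (P : pred I) (a : I -> A) (v : V) :
  smod_act (\sum_(i <- r | P i) a i) v = \sum_(i <- r | P i) smod_act (a i) v.
Proof.
by apply: (big_morph (fun a => smod_act a v)) => [x y|]; [exact: smodDl|exact: smod0l].
Qed.

Lemma smod_grZ q c (v : V) : smod_gr q v -> smod_gr q (c *: v).
Proof.
move=> h; rewrite -[_ *: _]addr0; apply: (smod_grP (smodP V)) => //.
exact: (smod_gr0 (smodP V)).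
Qed.

Lemma smod_grD q (u v : V) : smod_gr q u -> smod_gr q v -> smod_gr q (u + v).
Proof. by rewrite -{2}[u]scale1r; exact: (smod_grP (smodP V)). Qed.

Lemma parity_parts (v : V) :
  exists w : V * V, [/\ smod_gr false w.1, smod_gr true w.2 & v = w.1 + w.2].
Proof. by have [v0 [v1 [? ? ?]]] := smod_split (smodP V) v; exists (v0, v1). Qed.

(** This projection turns statements on gradings into identities of linear maps,
    which a universal property can prove. *)
Definition even_part (v : V) : V := (sval (cid (parity_parts v))).1.

Lemma even_partE (a b : V) : smod_gr false a -> smod_gr true b -> even_part (a + b) = a.
Proof.
move=> ga gb; rewrite /even_part; case: cid => -[a' b'] /= [ga' gb' ab].
have e : a - a' = b' - b.
  by apply/eqP; rewrite subr_eq addrAC [b' + a']addrC -ab addrK.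
have g0 : smod_gr false (a - a').
  by apply: smod_grD => //; rewrite -scaleN1r; exact: smod_grZ.
have g1 : smod_gr true (a - a').
  by rewrite e; apply: smod_grD => //; rewrite -scaleN1r; exact: smod_grZ.
by apply/esym/eqP; rewrite -subr_eq0; apply/eqP; exact: (smod_disj (smodP V)).
Qed.

Lemma even_part_linear : linear even_part.
Proof.
move=> c u v; have [[u0 u1] /= [gu0 gu1 ->]] := parity_parts u.
have [[v0 v1] /= [gv0 gv1 ->]] := parity_parts v.
have -> : c *: (u0 + u1) + (v0 + v1) = (c *: u0 + v0) + (c *: u1 + v1).
  by rewrite scalerDr addrACA.
by rewrite !even_partE //; apply: smod_grD => //; exact: smod_grZ.
Qed.
HB.instance Definition _ :=
  GRing.isLinear.Build F V V *:%R even_part even_part_linear.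

Lemma even_part_id (v : V) : smod_gr false v -> even_part v = v.
Proof.
move=> gv; rewrite -{1}[v]addr0 even_partE //; exact: (smod_gr0 (smodP V)).
Qed.

Lemma even_part_odd (v : V) : smod_gr true v -> even_part v = 0.
Proof.
move=> gv; rewrite -[v]add0r even_partE //; exact: (smod_gr0 (smodP V)).
Qed.

Lemma smod_gr_even (v : V) : even_part v = v -> smod_gr false v.
Proof. by move=> <-; have [w [? ? ->]] := parity_parts v; rewrite even_partE. Qed.

Lemma smod_gr_odd (v : V) : even_part v = 0 -> smod_gr true v.
Proof.
have [w [g0 g1 ->]] := parity_parts v.
by rewrite even_partE // => ->; rewrite add0r.
Qed.

End Action.

Lemma even_part_hom (V W : supermod gA) (g : {linear V -> W}) :
  (forall v, g (even_part v) = even_part (g v)) ->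
  forall q v, smod_gr q v -> smod_gr q (g v).
Proof.
move=> h [] v gv.
  by apply: smod_gr_odd; rewrite -h even_part_odd ?linear0.
by apply: smod_gr_even; rewrite -h even_part_id.
Qed.

Lemma sisom_sym (V W : supermod gA) : sisom V W -> sisom W V.
Proof.
move=> [f [fact fgr] [g fK gK]].
have glin : linear g.
  by move=> c u v; apply: (can_inj fK); rewrite linearP !gK.
pose G : {linear W -> V} :=
  HB.pack g (GRing.isLinear.Build F W V *:%R g glin).
exists G; last by exists f.
split=> [a v|].
  by apply: (can_inj fK); rewrite fact /= !gK.
apply: even_part_hom => v; apply: (can_inj fK) => /=; rewrite !gK.
have [[v0 v1] /= [g0 g1 E]] := parity_parts (g v).
rewrite -[in LHS](gK v) E linearD /= !even_partE //; exact: fgr.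
Qed.

Lemma sisom_has_dim (V W : supermod gA) n : sisom V W -> has_dim W n -> has_dim V n.
Proof.
move=> [f _ bf] [g bg]; exists (g \o f : {linear V -> 'rV[F]_n}).
exact: bij_comp.
Qed.

End SupermoduleTheory.

Lemma has_dim_of_bij (F : fieldType) (V : lmodType F) n (g : {linear 'rV[F]_n -> V}) :
  (forall r, g r = 0 -> r = 0) -> (forall v, exists r, g r = v) -> has_dim V n.
Proof.
move=> inj surj; pose h v := sval (cid (surj v)).
have hK : cancel h g by move=> v; rewrite /h; case: cid.
have ginj : injective g.
  move=> x y xy; apply/eqP; rewrite -subr_eq0; apply/eqP/inj.
  by rewrite linearB xy subrr.
have hlin : linear h by move=> c u v; apply: ginj; rewrite linearP !hK.
pose H : {linear V -> 'rV[F]_n} :=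
  HB.pack h (GRing.isLinear.Build F V 'rV[F]_n *:%R h hlin).
exists H.
by exists g => // x; apply: ginj; rewrite hK.
Qed.

Lemma Ugl_ind (F : fieldType) (I : finType) (p : I -> bool) (P : rel I)
    (Q : Ugl F p P -> Prop) :
  (forall c, Q c%:A) -> (forall i j, Q (ugen F p P i j)) ->
  (forall x y, Q x -> Q y -> Q (x + y)) -> (forall x y, Q x -> Q y -> Q (x * y)) ->
  forall x, Q x.
Proof.
move=> Qc Qg QD QM x.
have <- : \pi_(Ugl F p P)%qT (repr x) = x by exact: reprK.
rewrite upiE; elim: (repr x) => //= [y ? z ?|y ? z ?]; [exact: QD|exact: QM].
Qed.

Definition drinfeld_universal (F : fieldType) (par : parity_seq) (pi : pyramid)
    (d : 'I_2 -> nat -> Wpi F par pi) (e f : nat -> Wpi F par pi)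
    (s : 'M[nat]_2) : Prop :=
  forall (B : algType F) d' e' f', drinfeld_rels par pi s d' e' f' ->
  exists phi : {lrmorphism Wpi F par pi -> B},
    drinfeld_agree s phi d e f d' e' f' /\
    forall psi : {lrmorphism Wpi F par pi -> B},
      drinfeld_agree s psi d e f d' e' f' -> psi =1 phi.

Section Generation.
Variables (F : fieldType) (par : parity_seq) (pi : pyramid) (s : 'M[nat]_2).
Local Notation W := (Wpi F par pi).
Variables (d : 'I_2 -> nat -> W) (e f : nat -> W).
Hypothesis rels : drinfeld_rels par pi s d e f.
Hypothesis univ : drinfeld_universal d e f s.

Let Gset : set W := [set w | (exists i r, (0 < r)%N /\ w = d i r) \/
  ((exists2 r, (s row1 row2 < r)%N & w = e r) \/
   (exists2 r, (s row2 row1 < r)%N & w = f r))]%classic.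

Let S := subalg (galg_pred Gset).
Let toS (w : W) : S := insubd (1 : S) w.
Let toSK w : galg_set Gset w -> subalg_val (toS w) = w.
Proof. by move=> h; rewrite /toS; apply: (@insubdK _ _ S); apply/asboolP. Qed.

Let dS i r : galg_set Gset (d i r).
Proof.
case: r => [|r]; first by rewrite (drel_d0 rels); exact: galg1.
by apply: galg_gen; left; exists i, r.+1.
Qed.
Let eS r : (s row1 row2 < r)%N -> galg_set Gset (e r).
Proof. by move=> h; apply: galg_gen; right; left; exists r. Qed.
Let fS r : (s row2 row1 < r)%N -> galg_set Gset (f r).
Proof. by move=> h; apply: galg_gen; right; right; exists r. Qed.
Let zS : galg_set Gset 0.
Proof. by have := galgZ 0 (galg1 Gset); rewrite scale0r. Qed.
Let subS x y : galg_set Gset x -> galg_set Gset y -> galg_set Gset (x - y).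
Proof. by move=> hx hy; apply: galgD => //; rewrite -scaleN1r; exact: galgZ. Qed.
Let sumS n (g : nat -> W) : (forall a, (a < n)%N -> galg_set Gset (g a)) ->
  galg_set Gset (\sum_(0 <= a < n) g a).
Proof.
elim: n => [|n IH] h; first by rewrite big_geq.
by rewrite big_nat_recr //=; apply: galgD; [apply: IH => a ?; apply: h; lia|exact: h].
Qed.

Let relsS : drinfeld_rels par pi s (fun i r => toS (d i r))
  (fun r => toS (e r)) (fun r => toS (f r)).
Proof.
split.
- by move=> i; apply: val_inj; rewrite /= toSK // (drel_d0 rels).
- move=> r h; apply: val_inj; rewrite /= toSK // (drel_top rels) //.
- move=> i j r t r0 t0; apply: val_inj; rewrite /= !toSK //.
  exact: (drel_dd rels).
- move=> r t r0 t0; apply: val_inj; rewrite /= !toSK //; try exact: eS.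
  exact: (drel_ee rels).
- move=> r t r0 t0; apply: val_inj; rewrite /= !toSK //; try exact: fS.
  exact: (drel_ff rels).
- have [dt dtE ef] := drel_ef rels.
  have dtS r : galg_set Gset (dt r).
    elim/ltn_ind: r => r IH; rewrite (dt_rec rels dtE); apply: subS.
      by case: (r == 0); [exact: galg1|exact: zS].
    by apply: sumS => a ar; apply: galgM => //; exact: IH.
  exists (fun r => toS (dt r)) => [r|r t r0 t0]; apply: val_inj.
    rewrite raddf_sum /= rmorph_nat -dtE; apply: eq_bigr => a _.
    by rewrite !toSK.
  rewrite /= raddf_sum /= !toSK //; [|exact: fS|exact: eS].
  by rewrite ef //; congr (_ *: _); apply: eq_bigr => a _; rewrite !toSK.
- move=> i r t r0 t0; apply: val_inj; rewrite /= raddf_sum /= !toSK //; try exact: eS.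
  rewrite (drel_de rels) //; congr (_ *: _); apply: eq_big_nat => a ar.
  by rewrite /= !toSK //; apply: eS; lia.
- move=> i r t r0 t0; apply: val_inj; rewrite /= raddf_sum /= !toSK //; try exact: fS.
  rewrite (drel_df rels) //; congr (- (_ *: _)); apply: eq_big_nat => a ar.
  by rewrite /= !toSK //; apply: fS; lia.
Qed.

(** The generators satisfy the relations inside the subalgebra that they
    generate, so there is a homomorphism from the whole algebra to this subalgebra
    that fixes them; by uniqueness it is the identity. *)
Lemma drinfeld_generate w : galg_set Gset w.
Proof.
have [phi [[pd pe pf] _]] := univ relsS.
have [psi [_ uniq]] := univ rels.
pose incl : {lrmorphism S -> W} := subalg_val.
have h1 : idfun =1 psi by apply: uniq.
have h2 : incl \o phi =1 psi.
  by apply: uniq; split=> [i r h|r h|r h] /=; rewrite ?pd ?pe ?pf // toSK //; auto.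
by rewrite -[w]/(idfun w) h1 -h2 /=; case: (phi w) => /= x /asboolP.
Qed.

Lemma drinfeld_ind (Q : W -> Prop) : Q 1 ->
  (forall x y, Q x -> Q y -> Q (x + y)) -> (forall c x, Q x -> Q (c *: x)) ->
  (forall x y, Q x -> Q y -> Q (x * y)) ->
  (forall i r, (0 < r)%N -> Q (d i r)) ->
  (forall r, (s row1 row2 < r)%N -> Q (e r)) ->
  (forall r, (s row2 row1 < r)%N -> Q (f r)) -> forall w, Q w.
Proof.
move=> Q1 QD QZ QM Qd Qe Qf w; elim: (drinfeld_generate w); auto.
by move=> x [[i [r [r0 ->]]]|[[r h ->]|[r h ->]]]; auto.
Qed.

End Generation.

(** * Irreducible highest weight modules *)

Section HighestWeight.
Variables (F : fieldType) (par : parity_seq) (pi : pyramid) (s : 'M[nat]_2).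
Hypothesis two_neq0 : 2%:R != 0 :> F.
Local Notation W := (Wpi F par pi).
Variables (d : 'I_2 -> nat -> W) (e f : nat -> W).
Hypothesis rels : drinfeld_rels par pi s d e f.
Hypothesis univ : drinfeld_universal d e f s.
Hypothesis bot_top : bot pi = (top pi + (s row1 row2 + s row2 row1))%N.

Variables (V : supermod (@Wgr F par pi)) (w0 : V) (p q : nat -> F).
Hypothesis w0n0 : w0 <> 0.
Hypotheses (p0 : p 0%N = 1) (p_top : forall r, (top pi < r)%N -> p r = 0).
Hypotheses (q0 : q 0%N = 1) (q_bot : forall r, (bot pi < r)%N -> q r = 0).
Hypothesis d1w0 : forall r, (0 < r <= top pi)%N -> smod_act (d row1 r) w0 = p r *: w0.
Hypothesis d2w0 : forall r, (0 < r)%N -> smod_act (d row2 r) w0 = q r *: w0.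
Hypothesis ew0 : forall r, (s row1 row2 < r)%N -> smod_act (e r) w0 = 0.

Variables (n : nat) (P Q G : {poly F}).
Hypotheses (Pm : P \is monic) (Gm : G \is monic) (szP : size P = n.+1).
Hypothesis PQ : coprimep P Q.
Hypothesis PGE : P * G = \poly_(t < (top pi).+1) p (top pi - t)%N.
Hypothesis QGE : Q * G = \poly_(t < (bot pi).+1) q (bot pi - t)%N.
Variable Psi : {linear 'rV[F]_(2 ^ n) -> V}.
Hypothesis Psi_surj : forall v, exists r, Psi r = v.

Let orbit (v : V) : Prop := exists w : W, v = smod_act w w0.

Let d1w0' r : smod_act (d row1 r) w0 = p r *: w0.
Proof.
case: (posnP r) => [->|r0]; first by rewrite (drel_d0 rels) smod1 p0 scale1r.
have [h|h] := leqP r (top pi); first by rewrite d1w0 ?r0.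
by rewrite (drel_top rels h) p_top // smod0l scale0r.
Qed.

Let d2w0' r : smod_act (d row2 r) w0 = q r *: w0.
Proof.
case: (posnP r) => [->|/d2w0 //].
by rewrite (drel_d0 rels) smod1 q0 scale1r.
Qed.

Lemma ratio_central dt :
  (forall r, \sum_(0 <= a < r.+1) dt a * d row1 (r - a)%N = (r == 0)%:R) ->
  forall m w, ratio d dt m * w = w * ratio d dt m.
Proof.
move=> dtE m; apply: (drinfeld_ind rels univ).
- by rewrite mulr1 mul1r.
- by move=> x y hx hy; rewrite mulrDl mulrDr hx hy.
- by move=> c x hx; rewrite -scalerAl -scalerAr hx.
- by move=> x y hx hy; rewrite mulrA hx -!mulrA hy.
- by move=> i r _; exact: (ratio_comm_d rels dtE).
- by move=> r h; exact: (ratio_comm_e rels dtE).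
- by move=> r h; exact: (ratio_comm_f rels dtE).
Qed.

(** Being central, the coefficients of [d_1(u)^-1 d_2(u)] act on the submodule
    generated by [w0] by their eigenvalues on [w0]. *)
Let vac_scalar dt :
  (forall r, \sum_(0 <= a < r.+1) dt a * d row1 (r - a)%N = (r == 0)%:R) ->
  exists g : nat -> F, (forall m u, orbit u -> smod_act (ratio d dt m) u = g m *: u) /\
   forall m, \sum_(a < m.+1) p a * g (m - a)%N = q m.
Proof.
move=> dtE.
have dtw r : exists c, smod_act (dt r) w0 = c *: w0.
  elim/ltn_ind: r => r IH; rewrite (dt_rec rels dtE) smodDl smodNl big_mkord smod_suml.
  have [g gE] : exists g : 'I_r -> F, forall a : 'I_r, smod_act (dt a) w0 = g a *: w0.
    exists (fun a : 'I_r => sval (cid (IH a (ltn_ord a)))) => a; by case: cid.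
  exists ((r == 0)%:R - \sum_(a < r) p (r - a)%N * g a).
  rewrite scalerBl; congr (_ - _).
    by case: (r == 0); rewrite ?smod1 ?smod0l ?scale1r ?scale0r.
  rewrite scaler_suml; apply: eq_bigr => a _.
  by rewrite smodM d1w0' linearZ /= gE scalerA.
have [del delE] : exists g : nat -> F, forall a, smod_act (dt a) w0 = g a *: w0.
  by exists (fun a => sval (cid (dtw a))) => a; case: cid.
pose g m := \sum_(a < m.+1) q (m - a)%N * del a.
have gw m : smod_act (ratio d dt m) w0 = g m *: w0.
  rewrite smod_suml scaler_suml; apply: eq_bigr => a _.
  by rewrite smodM d2w0' linearZ /= delE scalerA.
exists g; split=> [m _ [w ->]|m].
  by rewrite -smodM ratio_central // smodM gw linearZ.
have := congr1 (fun x => smod_act x w0) (d1_ratio rels dtE m).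
rewrite smod_suml d2w0' => /eqP; rewrite -subr_eq0.
have -> : \sum_(a < m.+1) smod_act (d row1 a * ratio d dt (m - a)) w0 =
    (\sum_(a < m.+1) p a * g (m - a)%N) *: w0.
  rewrite scaler_suml; apply: eq_bigr => a _.
  by rewrite smodM gw linearZ /= d1w0' scalerA mulrC.
rewrite -scalerBl scaler_eq0 => /orP[|/eqP //].
by rewrite subr_eq0 => /eqP.
Qed.

(** Combinations of the [e] and of the [f] are indexed by polynomials, in such a
    way that the anticommutator of [Eel g] and [Fel h] depends on [g * h] only. *)
Let Eel (g : {poly F}) : W := \sum_(x < size g) g`_x *: e (s row1 row2 + x).+1.
Let Fel (h : {poly F}) : W :=
  (-1) ^+ par row1 *: \sum_(y < size h) h`_y *: f (s row2 row1 + y).+1.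

Let Eel_anti g h : Eel g * Eel h = - (Eel h * Eel g).
Proof.
apply/eqP; rewrite -addr_eq0; apply/eqP.
rewrite !mulr_suml; under [X in _ + X]eq_bigr do rewrite mulr_sumr.
rewrite exchange_big -big_split big1 // => x _; rewrite mulr_sumr -big_split big1 // => y _.
rewrite /= -!scalerAl -!scalerAr !scalerA [h`_y * _]mulrC -scalerDr.
by rewrite (drel_ee rels) ?scaler0 // ltnS leq_addr.
Qed.

Let Eel_sq g : Eel g * Eel g = 0.
Proof.
have := Eel_anti g g; move/eqP; rewrite -addr_eq0 -mulr2n -scaler_nat.
by rewrite scaler_eq0 (negbTE two_neq0) => /eqP.
Qed.

Let Ew0 g : smod_act (Eel g) w0 = 0.
Proof.
rewrite smod_suml big1 // => x _; rewrite smodZl ew0 ?scaler0 //.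
by rewrite ltnS leq_addr.
Qed.

Let szPG : size (P * G) = (top pi).+1.
Proof. rewrite PGE size_poly_eq // subnn p0; exact: oner_neq0. Qed.

Let pairing g h u : (0 < top pi)%N -> orbit u -> smod_act (Eel g) (smod_act (Fel h) u) =
  (((Q * G) * (g * h)) %% (P * G))`_(size (P * G)).-2 *: u
    - smod_act (Fel h) (smod_act (Eel g) u).
Proof.
move=> top0 ou; apply/eqP; rewrite eq_sym subr_eq eq_sym; apply/eqP.
rewrite -!smodM -smodDl.
have [dt dtE ef] := drel_ef rels.
have [gam [gamE gamR]] := vac_scalar dtE.
have anti : Eel g * Fel h + Fel h * Eel g =
    \sum_(x < size g) \sum_(y < size h) (g`_x * h`_y) *:
      ratio d dt (s row1 row2 + s row2 row1 + (x + y)).+1.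
  rewrite -scalerAr -scalerAl -scalerDr !mulr_suml.
  under [X in _ + X]eq_bigr do rewrite mulr_sumr.
  rewrite exchange_big -big_split scaler_sumr; apply: eq_bigr => x _.
  rewrite mulr_sumr -big_split scaler_sumr; apply: eq_bigr => y _ /=.
  rewrite -!scalerAl -!scalerAr !scalerA [h`_y * _]mulrC -scalerDr scalerA.
  rewrite ef ?ltnS ?leq_addr // scalerA mulrAC -expr2 sqrr_sign mul1r.
  congr (_ *: _); rewrite /ratio /conv big_mkord.
  have -> : ((s row1 row2 + x).+1 + (s row2 row1 + y).+1)%N =
    (s row1 row2 + s row2 row1 + (x + y)).+2 by lia.
  by apply: eq_bigr => a _; rewrite subn1.
rewrite {}anti smod_suml szPG /=.
pose phi (r : {poly F}) := ((Q * G) * r %% (P * G))`_(top pi).-1.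
have phiX m : phi 'X^m = gam (s row1 row2 + s row2 row1 + m).+1.
  apply: coef_modp_shift p_top _ gamR PGE _ top0 m => //; by rewrite -bot_top.
have phi_lin : linear (phi : {poly F} -> F^o).
  by move=> c a b; rewrite /phi mulrDr -scalerAr modpD modpZl coefD coefZ.
pose phiL : {linear {poly F} -> F^o} :=
  HB.pack phi (GRing.isLinear.Build F {poly F} F^o *:%R phi phi_lin).
have -> : (Q * G * (g * h) %% (P * G))`_(top pi).-1 = phiL (g * h) by [].
have -> : g * h = \sum_(x < size g) \sum_(y < size h) (g`_x * h`_y) *: 'X^(x + y).
  rewrite -{1}[g]coefK -{1}[h]coefK !poly_def mulr_suml; apply: eq_bigr => x _.
  rewrite mulr_sumr; apply: eq_bigr => y _.
  by rewrite -scalerAl -scalerAr scalerA -exprD.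
rewrite linear_sum scaler_suml; apply: eq_bigr => x _.
rewrite smod_suml linear_sum scaler_suml; apply: eq_bigr => y _.
rewrite smodZl gamE // -phiX scalerA; congr (_ *: _).
exact: (esym (linearZZ phiL _ _)).
Qed.

Let n_le_top : (n <= top pi)%N.
Proof.
have := szPG; rewrite size_monicM ?monic_neq0 // szP.
have : (0 < size G)%N by rewrite size_poly_gt0 monic_neq0.
by case: (size G) => // c _; rewrite addnS addSn /= => -[<-]; exact: leq_addr.
Qed.

(** The Clifford operators turn [w0] into [2 ^ n] independent vectors, as many as
    [V] can have. So [w0] generates [V], the anticommutators are scalars on all of
    [V], and the same count applies to a vacuum vector of any nonzero submodule. *)
Lemma highest_weight_irreducible :
  [/\ forall v : V, exists w : W, v = smod_act w w0, has_dim V (2 ^ n) & irreducible V].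
Proof.
have [Q' QQ'] : exists Q', P %| Q * Q' - 1.
  have [[u v] /= uv] := Bezout_eq1_coprimepP P Q PQ.
  by exists v; rewrite -uv opprD addrCA [v * Q]mulrC subrr addr0 dvdpNr dvdp_mull.
(* These choices make the anticommutators of the [EE i] and [FF j] triangular. *)
pose Egen i := Eel (Q' * 'X^(n.-1 - i)).
pose EE i : {linear V -> V} := smod_act (Egen i).
pose FF j : {linear V -> V} := smod_act (Fel 'X^j).
have EF i j u : (j <= i < n)%N -> orbit u ->
    EE i (FF j u) = (i == j)%:R *: u - FF j (EE i u).
  move=> ij ou; rewrite /EE /FF /= pairing //; last by move: n_le_top ij; lia.
  by rewrite hankel_dual.
have orbitL c u v : orbit u -> orbit v -> orbit (c *: u + v).
  by move=> [a ->] [b ->]; exists (c *: a + b); rewrite smodDl smodZl.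
have orbitA a u : orbit u -> orbit (smod_act a u).
  by move=> [b ->]; exists (a * b); rewrite smodM.
have orbitF j u : orbit u -> orbit (FF j u) by exact: orbitA.
have orbit0 : orbit w0 by exists 1; rewrite smod1.
have Ek i : (i < n)%N -> EE i w0 = 0 by move=> _; exact: Ew0.
have surj := fock_surj orbitL orbitF orbit0 w0n0 Ek EF erefl Psi_surj.
have all_orbit v : orbit v.
  have [r <-] := surj v.
  exact: (fock_in orbitL orbitF orbit0 r).
split=> //.
  rewrite -fdimE.
  refine (@has_dim_of_bij F V (fdim n) (fock FF w0 (m:=n)) _ surj) => r.
  exact: (fock_inj orbitL orbitF orbit0 w0n0 Ek EF (leqnn n)).
split; first by exists w0.
move=> N [N0 NL NA _].
have [[x [Nx x0]]|none] := pselect (exists x, N x /\ x <> 0); last first.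
  left; apply/seteqP; split=> [x Nx|_ -> //] /=.
  by have [//|x0] := pselect (x = 0); case: none; exists x.
right; apply/seteqP; split=> // v _.
have anti i j y : EE i (EE j y) = - EE j (EE i y).
  by rewrite /EE /= -!smodM Eel_anti smodNl.
have sq i y : EE i (EE i y) = 0.
  by rewrite /EE /= -!smodM Eel_sq smod0l.
have [y [Ny y0 Ey]] := exists_vacuum n anti sq (fun i u => NA (Egen i) u) Nx x0.
have EF' i j u : (j <= i < n)%N -> N u ->
    EE i (FF j u) = (i == j)%:R *: u - FF j (EE i u) by move=> ? _; exact: EF.
have NF j u : N u -> N (FF j u) by exact: NA.
have [r <-] := fock_surj NL NF Ny y0 Ey EF' erefl Psi_surj v.
exact: (fock_in NL NF Ny r).
Qed.

End HighestWeight.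

(** * The Miura transform on a highest weight vector *)

Section IncreasingSequences.
Variables (F : fieldType) (n r : nat).

Definition increasing (u : {ffun 'I_r -> 'I_n}) : bool :=
  sorted (fun x y : 'I_n => (x < y)%N) (codom u).

Let lt_tr : transitive (fun x y : 'I_n => (x < y)%N).
Proof. by move=> y x z; exact: ltn_trans. Qed.

Let lt_irr : irreflexive (fun x y : 'I_n => (x < y)%N).
Proof. by move=> x; exact: ltnn. Qed.

Lemma increasing_inj u : increasing u -> injective u.
Proof. by move/(sorted_uniq lt_tr lt_irr)/injectiveP. Qed.

Lemma sorted_enum_ord_set (S : {set 'I_n}) :
  sorted (fun x y : 'I_n => (x < y)%N) (enum S).
Proof.
rewrite {1}/enum_mem; apply: (subseq_sorted lt_tr) (filter_subseq _ _) _.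
have := iota_ltn_sorted 0 n; rewrite -val_enum_ord sorted_map.
by rewrite enumT.
Qed.

(** A subset of ['I_n] is enumerated by exactly one increasing sequence. *)
Lemma esym_val_increasing (a : 'I_n -> F) :
  esym_val a r = \sum_(u | increasing u) \prod_(i < r) a (u i).
Proof.
pose im (u : {ffun 'I_r -> 'I_n}) : {set 'I_n} := [set u i | i : 'I_r].
have imE : [set S : {set 'I_n} | #|S| == r] = im @: [set u | increasing u].
  apply/setP => S; rewrite inE; apply/eqP/imsetP => [Sr|[u]].
    have szS : size (enum S) == r by rewrite -cardE Sr.
    pose u : {ffun 'I_r -> 'I_n} := [ffun i => tnth (Tuple szS) i].
    have uE : codom u = enum S.
      rewrite -[RHS]/(tval (Tuple szS)) -map_tnth_enum.
      by apply: eq_map => i; rewrite ffunE.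
    exists u; first by rewrite inE /increasing uE sorted_enum_ord_set.
    apply/setP => x; rewrite -mem_enum -uE.
    by apply/codomP/imsetP => -[j]; [exists j|move=> _ ->; exists j].
  rewrite inE => ui ->; rewrite card_imset; last exact: increasing_inj.
  by rewrite -[RHS]card_ord; apply: eq_card => i; rewrite !inE.
rewrite /esym_val (eq_bigl (mem (im @: [set u | increasing u]))); last first.
  by move=> S; have := congr1 (fun X : {set {set 'I_n}} => S \in X) imE; rewrite !inE.
rewrite big_imset /=; last first.
  move=> u v; rewrite !inE => ui vi uv.
  have cuv : codom u = codom v.
    apply: (irr_sorted_eq lt_tr lt_irr ui vi) => x.
    apply/codomP/codomP => -[i ->].
      have : u i \in im v by rewrite -uv imset_f.
      by case/imsetP => j _ ->; exists j.
    have : v i \in im u by rewrite uv imset_f.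
    by case/imsetP => j _ ->; exists j.
  by apply/ffunP => i; move/eq_in_map: cuv; apply; rewrite mem_enum.
rewrite (eq_bigl increasing) => [|u]; last by rewrite inE.
apply: eq_bigr => u ui; rewrite big_imset /=; last first.
  by move=> i j _ _; exact: increasing_inj.
by apply: eq_bigl => i; rewrite inE.
Qed.
End IncreasingSequences.

Lemma prod_ord_eq0 (R : nzRingType) n (f : 'I_n -> R) a :
  f a = 0 -> \prod_(i < n) f i = 0.
Proof.
elim: n f a => [|n IH] f a fa; first by case: a fa.
rewrite big_ord_recl; case: (unliftP ord0 a) fa => [b|] -> fa.
  by rewrite (IH (fun i => f (lift ord0 i)) b) ?mulr0.
by rewrite fa mul0r.
Qed.

Lemma scale_swap (F : fieldType) (A : algType F) (u v w : A) (a b c : F) :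
  u * v = c *: (v * u) -> (a *: u) * ((b *: v) * w) = c *: ((b *: v) * ((a *: u) * w)).
Proof.
move=> uv; rewrite -!scalerAl -!scalerAr !scalerA !mulrA uv -scalerAl scalerA.
by congr (_ *: _); ring.
Qed.

Section Miura.
Variables (F : fieldType) (par : parity_seq) (pi : pyramid).
Local Notation box := 'I_(nbox par pi).
Local Notation bp := (@bpar par pi).
Local Notation Up := (Ugl F bp (@le_col par pi)).
Local Notation Uh := (Ugl F bp (@eq_col par pi)).
Local Notation uh i j := (ugen F bp (@eq_col par pi) i j).

Lemma row_cases (r : 'I_2) : r = row1 \/ r = row2.
Proof. by case: r => -[|[|//]] h; [left|right]; apply: val_inj. Qed.

Lemma SshiftK (u : Up) : Sshift par pi (-1) (Sshift par pi 1 u) = u.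
Proof.
elim/Ugl_ind: u => [c|i j|x y hx hy|x y hx hy].
- by rewrite !linearZ /= !rmorph1.
- rewrite /= ulift_gen /shift_gen linearD linearZ /= rmorph1 ulift_gen /shift_gen.
  by rewrite -addrA -scalerDl mul1r mulN1r mulrN addNr scale0r addr0.
- by rewrite !linearD; congr (_ + _); [exact: hx|exact: hy].
- by rewrite !rmorphM; congr (_ * _); [exact: hx|exact: hy].
Qed.

Definition ebarh (y : box * box) : Uh := (-1) ^+ bp y.1 *: uh y.1 y.2.

(** The shift by [rho] cancels, and the projection to degree zero kills every term
    with a factor that changes columns; as the degrees add up to [r - s], only the
    terms with [s = r] survive. *)
Lemma mu_t_gen (i j : 'I_2) z r (x : Wpi F par pi) : (0 < r)%N ->
  subalg_val x = t_gen F par pi i j z r ->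
  mu F par pi x = \sum_(w : {ffun 'I_r -> box * box} | t_index i j z r w)
    (-1) ^+ #|[set a : 'I_r | (a.+1 < r)%N && (brow (w a).2 < z)%N]| *:
    \prod_(y <- codom w) ebarh y.
Proof.
move=> r0 xE; rewrite /mu /= xE /t_gen SshiftK linear_sum.
rewrite (big_nat_recr r) //= big_nat_cond big1 ?add0r => [|t /andP[/andP[t0 tr] _]].
  rewrite subnn expr0 scale1r linear_sum; apply: eq_bigr => w _.
  rewrite linearZ rmorph_prod; congr (_ *: _).
  rewrite /image_mem big_map enumT /=.
  apply: eq_bigr => a _; rewrite /ebar linearZ /= ulift_gen //.
rewrite linearZ /= linear_sum big1 ?scaler0 // => w tw.
rewrite linearZ rmorph_prod /=.
have [a aE] : exists a : 'I_t, bcol (w a).1 != bcol (w a).2.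
  apply/existsP; apply: contraT; rewrite negb_exists => /forallP h.
  case/and5P: tw => _ _ _ _; rewrite big1 => [|a _]; first by lia.
  by have := h a; rewrite negbK => /eqP ->; rewrite subnn.
rewrite (@prod_ord_eq0 _ _ _ a) ?scaler0 // /ebar linearZ /= ulift_gen.
by rewrite /pr_gen (proj1 (ugen_rel F bp (@eq_col par pi))) ?scaler0.
Qed.

Variables (X : supermod (@ugr F _ bp (@eq_col par pi))) (w0 : X) (val : box -> F).
Hypothesis diag : forall x, smod_act (ebarh (x, x)) w0 = val x *: w0.
Hypothesis up : forall i j, bcol i = bcol j -> brow i = row1 -> brow j = row2 ->
  smod_act (uh i j) w0 = 0.

Local Notation act l := (smod_act (\prod_(y <- l) ebarh y) w0).
Local Notation flat := (fun y : box * box => bcol y.1 == bcol y.2).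
Definition chain z (x y : box * box) : bool := (brow y.1 == brow x.2) &&
  (if (brow x.2 < z)%N then bcol y.1 <= bcol x.2 else bcol x.2 < bcol y.1)%N.

Lemma act_cons x l : act (x :: l) = smod_act (ebarh x) (act l).
Proof. by rewrite big_cons smodM. Qed.

(** Generators in different columns supercommute, so a first factor [e_{1,2}] can
    be moved past factors of the other columns, to the vector that it kills. *)
Lemma act_up x l : flat x -> brow x.1 = row1 -> brow x.2 = row2 ->
  all flat l -> all (fun y => bcol x.1 < bcol y.1)%N l -> act (x :: l) = 0.
Proof.
move=> fx x1 x2 fl xl.
suff [b ->] : exists b : bool, \prod_(y <- x :: l) ebarh y =
    (-1) ^+ b *: (\prod_(y <- l) ebarh y * ebarh x).
  by rewrite smodZl smodM smodZl up ?scaler0 ?linear0 ?scaler0 //; exact/eqP.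
elim: l fl xl => [|y l IH] /=; first by exists false; rewrite big_seq1 big_nil mul1r scale1r.
move=> /andP[fy fl] /andP[xy xl]; have [b] := IH fl xl; rewrite !big_cons => E.
have [_ /(_ x.1 x.2 y.1 y.2 fx fy)] := ugen_rel F bp (@eq_col par pi).
have ne : bcol x.1 != bcol y.1 by rewrite ltn_neqAle in xy; case/andP: xy.
have n1 : (x.2 == y.1) = false.
  by apply/negbTE; apply: contraNneq ne => <-; rewrite (eqP fx).
have n2 : (x.1 == y.2) = false.
  by apply/negbTE; apply: contraNneq ne => ->; rewrite (eqP fy).
rewrite n1 n2 mulr0 !scale0r subrr => /eqP; rewrite subr_eq0 => /eqP comm.
exists (b (+) ((bp x.1 (+) bp x.2) && (bp y.1 (+) bp y.2))).
have -> : ebarh x * (ebarh y * \prod_(z <- l) ebarh z) =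
   (-1) ^+ ((bp x.1 (+) bp x.2) && (bp y.1 (+) bp y.2)) *:
     (ebarh y * (ebarh x * \prod_(z <- l) ebarh z)).
  exact: scale_swap.
by rewrite E -scalerAr scalerA -signr_addb addbC mulrA.
Qed.

Lemma chain_incr z x l : path (chain z) x l -> all flat (x :: l) ->
  all (fun y => ~~ (brow y.2 < z)%N) (x :: l) ->
  all (fun y => bcol x.1 < bcol y.1)%N l.
Proof.
elim: l x => //= y l IH x /andP[/andP[_ xy] p] /and3P[fx fy fl] /and3P[zx zy zl].
move: xy; rewrite (negbTE zx) -(eqP fx) => xy; rewrite xy /=.
apply: sub_all (IH y p _ _); rewrite /= ?fy ?zy //.
by move=> t; exact: ltn_trans.
Qed.

(** As the columns increase throughout, any step from row 1 to row 2 kills the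
    highest weight vector; otherwise the sequence never leaves row 1. *)
Lemma act_start1 x l : path (chain 0) x l -> all flat (x :: l) ->
  brow x.1 = row1 -> brow (last x l).2 = row1 ->
  act (x :: l) = 0 \/
  all (fun y => (brow y.1 == row1) && (brow y.2 == row1)) (x :: l).
Proof.
elim: l x => [|y l IH] x; first by move=> _ _ x1 x2; right; rewrite /= x1 x2.
move=> /[dup] p /= /andP[/andP[/eqP yx _] py] /[dup] f /andP[fx fl] x1 xl.
have [x2|x2] := row_cases (brow x.2).
  rewrite act_cons; have [-> |h] := IH y py fl (etrans yx x2) xl.
    by left; rewrite linear0.
  by right; rewrite x1 x2 /=.
left; apply: act_up => //.
apply: (chain_incr p f); exact/allP.
Qed.

(** When the columns increase only after a stay in row 2, consider the last step
    from row 1 to row 2: all later factors stay in row 2 and lie in larger columns,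
    so this step kills the highest weight vector. *)
Lemma act_end2 x l : path (chain 1) x l -> all flat (x :: l) ->
  brow (last x l).2 = row2 ->
  (brow x.1 = row1 -> act (x :: l) = 0) /\
  (brow x.1 = row2 -> act (x :: l) = 0 \/
    all (fun y => (brow y.1 == row2) && (brow y.2 == row2)) (x :: l)).
Proof.
elim: l x => [|y l IH] x.
  move=> _ /= /andP[fx _] x2; split=> x1; first exact: act_up.
  by right; rewrite x1 x2.
move=> /[dup] p /= /andP[/andP[/eqP yx _] py] /[dup] f /andP[fx fl] xl.
have [IH1 IH2] := IH y py fl xl; rewrite act_cons.
have [x2|x2] := row_cases (brow x.2).
  rewrite IH1 ?linear0; last by rewrite yx.
  by split=> // _; left.
have [-> |h] := IH2 (etrans yx x2); first by rewrite linear0; split=> // _; left.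
split=> x1; last by right; rewrite x1 x2.
rewrite -act_cons; apply: act_up => //; apply: (chain_incr p f).
have hh : all (fun t : box * box => ~~ (brow t.2 < 1)%N) (y :: l).
  by apply: sub_all h => t /andP[_ /eqP ->].
by apply/andP; split; rewrite ?x2.
Qed.

Lemma t_indexP i j z r (w : {ffun 'I_r.+1 -> box * box}) :
  t_index i j z r.+1 w <-> exists x l, codom w = x :: l /\
    [/\ path (chain z) x l, all flat (x :: l), brow x.1 = i & brow (last x l).2 = j].
Proof.
have wE (a : 'I_r.+1) : nth (w ord0) (codom w) a = w a.
  by rewrite (nth_map ord0) ?size_enum_ord // nth_ord_enum.
have szw : size (codom w) = r.+1 by rewrite size_codom card_ord.
have wl x l : codom w = x :: l -> last x l = w ord_max.
  by move=> E; rewrite -wE E /= (last_nth (w ord0)); congr nth; case: (szw); rewrite E => -[].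
split.
  case/and5P=> /forallP h1 /forallP h2 /forallP h3 /forallP h4 h5.
  case E : (codom w) (szw) => [//|x l] [szl]; exists x, l; split=> //.
  have flatw a : flat (w a).
    move: h5; rewrite subnn sum_nat_eq0 => /forallP /(_ a) /=.
    by rewrite subn_eq0 => h; rewrite eqn_leq h3 h.
  split.
  - apply/(pathP (w ord0)) => a; rewrite szl => al.
    have al1 : (a < r.+1)%N by lia.
    have al2 : (a.+1 < r.+1)%N by [].
    have := implyP (forallP (h4 (Ordinal al1)) (Ordinal al2)) (eqxx _).
    by rewrite -(wE (Ordinal al1)) -(wE (Ordinal al2)) E.
  - by rewrite -E; apply/allP => y /codomP[a ->]; exact: flatw.
  - by have /eqP := implyP (h1 ord0) (eqxx _); rewrite -wE E.
  - by rewrite (wl _ _ E); have /eqP := implyP (h2 ord_max) (eqxx _).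
case=> x [l [E [p fl xi xj]]].
have szl : size l = r by move: szw; rewrite E => -[].
have flatw a : flat (w a) by move: fl; rewrite -E => /allP; apply; exact: codom_f.
apply/and5P; split.
- apply/forallP => a; apply/implyP => /eqP a0.
  have -> : a = ord0 by apply: val_inj.
  by rewrite -wE E /= xi.
- apply/forallP => a; apply/implyP => /eqP [ar].
  have -> : a = ord_max by apply: val_inj.
  by rewrite -(wl _ _ E) xj.
- by apply/forallP => a; rewrite (eqP (flatw a)).
- apply/forallP => a; apply/forallP => b; apply/implyP => /eqP ba.
  have al : (a < size l)%N by rewrite szl -ltnS -ba.
  by have := pathP (w ord0) p _ al; rewrite -(wE a) -(wE b) ba E.
- by rewrite subnn big1 // => a _; rewrite (eqP (flatw a)) subnn.
Qed.

Lemma mu_e x r : (0 < r)%N -> subalg_val x = e_gen F par pi r ->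
  smod_act (mu F par pi x) w0 = 0.
Proof.
case: r => // r _ xE; rewrite (mu_t_gen _ xE) // smod_suml big1 // => w.
move=> /t_indexP[y [l [-> [p fl y1 y2]]]].
by have [h _] := act_end2 p fl y2; rewrite smodZl h ?scaler0.
Qed.

Definition row_off (i : 'I_2) : nat := if i == row1 then off pi else 0%N.

Lemma box_exists (i : 'I_2) m : (m < rowlen pi i)%N ->
  exists x : box, brow x = i /\ bcol x = (row_off i + m.+1)%N.
Proof.
move=> mi; have eo : even_row par <> odd_row par.
  by move=> /(congr1 par); rewrite par_even_row par_odd_row.
have [ie|io] : i = even_row par \/ i = odd_row par.
  by rewrite /even_row /odd_row; case: (par row1); case: (row_cases i) => ->; auto.
  subst i; exists (lshift _ (Ordinal mi)).
  by rewrite /bcol /brow /= mi.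
subst i; exists (rshift _ (Ordinal mi)).
by rewrite /bcol /brow /= ltnNge leq_addr /= addKn.
Qed.

Lemma box_index (x : box) :
  exists2 m, (m < rowlen pi (brow x))%N & bcol x = (row_off (brow x) + m.+1)%N.
Proof.
rewrite /bcol /brow; case: ltnP => h; first by exists x.
by exists (x - rowlen pi (even_row par))%N; rewrite // ltn_subLR // ltn_ord.
Qed.

(** Once all factors stay in row [i], each is a diagonal matrix unit and the
    admissible families are the increasing sequences of boxes of this row, so the
    eigenvalue is an elementary symmetric polynomial. *)
Lemma mu_d_row i z r x (a : 'I_(rowlen pi i) -> F) : (0 < r)%N -> (i < z)%N = false ->
  subalg_val x = t_gen F par pi i i z r ->
  (forall y (m : 'I_(rowlen pi i)), brow y = i -> bcol y = (row_off i + m.+1)%N ->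
     val y = a m) ->
  (forall y l, path (chain z) y l -> all flat (y :: l) -> brow y.1 = i ->
     brow (last y l).2 = i -> act (y :: l) = 0 \/
     all (fun y => (brow y.1 == i) && (brow y.2 == i)) (y :: l)) ->
  smod_act (mu F par pi x) w0 = esym_val a r *: w0.
Proof.
case: r => // r _ iz xE va dich; rewrite (mu_t_gen _ xE) // smod_suml.
have [rb rbP] : exists rb : 'I_(rowlen pi i) -> box, forall m,
    brow (rb m) = i /\ bcol (rb m) = (row_off i + m.+1)%N.
  exists (fun m => sval (cid (box_exists (ltn_ord m)))) => m.
  by case: cid.
pose inrow (w : {ffun 'I_r.+1 -> box * box}) :=
  all (fun y => (brow y.1 == i) && (brow y.2 == i)) (codom w).
rewrite (bigID inrow) /= [X in _ + X]big1 ?addr0; last first.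
  move=> w /andP[/t_indexP[y [l [E [p fl y1 y2]]]]]; rewrite /inrow E => nrow.
  rewrite smodZl; have [->|h] := dich y l p fl y1 y2; first by rewrite scaler0.
  by rewrite h in nrow.
pose ww (u : {ffun 'I_r.+1 -> 'I_(rowlen pi i)}) : {ffun 'I_r.+1 -> box * box} :=
  [ffun t => (rb (u t), rb (u t))].
have rb_inj : injective rb.
  move=> m m' /(congr1 (@bcol par pi)); rewrite !(proj2 (rbP _)) => /addnI [].
  exact: ord_inj.
have wwE u : codom (ww u) = [seq (rb m, rb m) | m <- codom u].
  by rewrite /codom /image_mem -map_comp; apply: eq_map => t; rewrite ffunE.
have sortE u : sorted (chain z) (codom (ww u)) = increasing u.
  rewrite wwE sorted_map; apply: eq_sorted => m m' /=.
  by rewrite /chain /= !(proj1 (rbP _)) eqxx iz !(proj2 (rbP _)) ltn_add2l ltnS.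
have wset : [set w | t_index i i z r.+1 w && inrow w] = ww @: [set u | increasing u].
  apply/setP => w; rewrite inE; apply/andP/imsetP => [[/t_indexP[y [l [E [p fl _ _]]]] iw]|].
    have uP t : exists m, w t = (rb m, rb m).
      have wt : w t \in codom w by exact: codom_f.
      move: iw => /allP /(_ _ wt) /andP[/eqP r1 /eqP r2].
      move: fl; rewrite -E => /allP /(_ _ wt) /eqP c12.
      case: (w t) r1 r2 c12 => /= b1 b2 r1 r2 c12.
      have -> : b2 = b1 by apply: box_inj; rewrite ?r1 ?r2.
      have [m mi bm] := box_index b1; rewrite r1 in mi bm.
      exists (Ordinal mi); congr (_, _); apply: box_inj;
        by rewrite ?(proj1 (rbP _)) ?(proj2 (rbP _)) ?r1.
    have wu : w = ww [ffun t => sval (cid (uP t))].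
      by apply/ffunP => t; rewrite !ffunE; case: cid.
    exists [ffun t => sval (cid (uP t))] => //.
    by rewrite inE -sortE -wu E.
  case=> u; rewrite inE -sortE => us ->.
  have iw : inrow (ww u).
    rewrite /inrow wwE all_map; apply/allP => m _ /=.
    by rewrite !(proj1 (rbP m)) eqxx.
  split=> //; apply/t_indexP.
  have szw : size (codom (ww u)) = r.+1 by rewrite size_codom card_ord.
  have fw : all flat (codom (ww u)) by rewrite wwE all_map; apply/allP => m _ /=.
  move: us iw szw fw; rewrite /inrow; case: (codom (ww u)) => [//|y l] us iw _ fw.
  exists y, l; split=> //; split=> //.
    by case/andP: iw => /andP[/eqP].
  by have /andP[_ /eqP] := allP iw _ (mem_last y l).
rewrite (eq_bigl (mem (ww @: [set u | increasing u]))); last first.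
  move=> w; have := congr1 (fun X : {set {ffun 'I_r.+1 -> box * box}} => w \in X) wset.
  by rewrite !inE.
rewrite big_imset /=; last first.
  move=> u v _ _ /ffunP uv; apply/ffunP => t; have := uv t; rewrite !ffunE => -[e _].
  exact: rb_inj.
rewrite esym_val_increasing scaler_suml; apply: eq_big => [u|u _]; first by rewrite inE.
rewrite eq_card0 => [|t]; last by rewrite inE ffunE (proj1 (rbP _)) iz andbF.
rewrite expr0 scale1r.
have -> : \prod_(t < r.+1) a (u t) = \prod_(m <- codom u) a m.
  by rewrite /codom /image_mem big_map big_enum.
rewrite wwE; elim: (codom u) => [|m l IH] /=; first by rewrite !big_nil smod1 scale1r.
rewrite act_cons IH linearZ /= diag scalerA big_cons mulrC.
by rewrite (va _ _ (proj1 (rbP m)) (proj2 (rbP m))).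
Qed.

End Miura.

(** * Columns of a standard module *)

Section Coordinates.
Variables (F : fieldType) (V : lmodType F) (v x : V).

Lemma coordinate1 : v <> 0 -> (forall u, exists a, u = a *: v) ->
  exists co : V -> F, (forall k u w, co (k *: u + w) = k * co u + co w) /\
    forall u, u = co u *: v.
Proof.
move=> v0 sp; pose co u := sval (cid (sp u)).
have coE u : u = co u *: v by rewrite /co; case: cid.
exists co; split=> // k u w.
have uniq a b : a *: v = b *: v -> a = b.
  by move/eqP; rewrite -subr_eq0 -scalerBl scaler_eq0 subr_eq0 => /orP[/eqP|/eqP].
by apply: uniq; rewrite -coE scalerDl -scalerA -!coE.
Qed.

Lemma coordinate2 : (forall a b, a *: v + b *: x = 0 -> a = 0 /\ b = 0) ->
  (forall u, exists a b, u = a *: v + b *: x) ->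
  exists co : bool -> V -> F,
    [/\ forall q k u w, co q (k *: u + w) = k * co q u + co q w,
        forall u, u = co false u *: v + co true u *: x &
        forall q q', co q (if q' then x else v) = (q == q')%:R].
Proof.
move=> ind sp.
have sp' u : exists ab : F * F, u = ab.1 *: v + ab.2 *: x.
  by have [a [b ->]] := sp u; exists (a, b).
pose co (q : bool) u := let ab := sval (cid (sp' u)) in if q then ab.2 else ab.1.
have coE u : u = co false u *: v + co true u *: x by rewrite /co; case: cid.
have uniq a b u : u = a *: v + b *: x -> co false u = a /\ co true u = b.
  move=> uE; have : (co false u - a) *: v + (co true u - b) *: x = 0.
    by rewrite !scalerBl addrACA -coE -opprD -uE subrr.
  by case/ind => /eqP + /eqP; rewrite !subr_eq0 => /eqP-> /eqP->.
exists co; split=> // [q k u w|q q'].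
  have [h1 h2] : co false (k *: u + w) = k * co false u + co false w /\
      co true (k *: u + w) = k * co true u + co true w.
    by apply: uniq; rewrite !scalerDl -!scalerA addrACA -scalerDr -!coE.
  by case: q.
have [h1 h2] : co false v = 1 /\ co true v = 0.
  by apply: uniq; rewrite scale1r scale0r addr0.
have [h3 h4] : co false x = 0 /\ co true x = 1.
  by apply: uniq; rewrite scale1r scale0r add0r.
by case: q; case: q'.
Qed.
End Coordinates.

Section Columns.
Variables (F : fieldType) (par : parity_seq) (pi : pyramid).
Hypothesis two_neq0 : 2%:R != 0 :> F.
Variable A : tableau F pi.

Definition uneq_columns : {set 'I_(bot pi)} :=
  [set c | [exists i, (topcol i == c) && (trow1 A i != trow2 A c)]].

Variables (c : 'I_(bot pi)) (L : supermod (@ugr F _ par (in_column par c))).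
Local Notation u11 := (ugen F par (in_column par c) row1 row1).
Local Notation u12 := (ugen F par (in_column par c) row1 row2).
Local Notation u21 := (ugen F par (in_column par c) row2 row1).
Local Notation u22 := (ugen F par (in_column par c) row2 row2).

(** [bas false] is a highest weight vector, and [bas true] completes it to a basis
    of a two-dimensional column. Setting [bas true] to zero for a one-dimensional
    column lets both kinds of columns be expanded in the same way. *)
Record column_basis (bas : bool -> L) (co : bool -> L -> F) : Prop := ColumnBasis {
  cb_even : smod_gr false (bas false);
  cb_22 : smod_act u22 (bas false) = ((-1) ^+ par row2 * trow2 A c) *: bas false;
  cb_11 : forall i, topcol i = c ->
    smod_act u11 (bas false) = ((-1) ^+ par row1 * trow1 A i) *: bas false;
  cb_12 : forall i : 'I_(top pi), topcol i = c -> smod_act u12 (bas false) = 0;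
  cb_lin : forall q k u w, co q (k *: u + w) = k * co q u + co q w;
  cb_co : forall u, u = co false u *: bas false + co true u *: bas true;
  cb_1 : co false (bas false) = 1;
  cb_out : c \notin uneq_columns -> bas true = 0;
  cb_in : c \in uneq_columns -> forall q q', co q (bas q') = (q == q')%:R }.

Lemma topcol_inj : injective (@topcol pi).
Proof. by move=> i j /(congr1 val) /= /addnI; exact: ord_inj. Qed.

Lemma has_box_row2 : has_box par row2 c.
Proof.
have [x [xr xc]] := box_exists par (ltn_ord c : c < rowlen pi row2)%N.
by apply/existsP; exists x; rewrite xr xc eqxx /=.
Qed.

Lemma has_box_row1 i : topcol i = c -> has_box par row1 c.
Proof.
move=> ic; have [x [xr xc]] := box_exists par (ltn_ord i : i < rowlen pi row1)%N.
by apply/existsP; exists x; rewrite xr xc -ic eqxx /= addnS.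
Qed.

(** On a column of height two with entries a and b, [e_{1,2} e_{2,1}] multiplies
    the highest weight vector by a - b up to sign. If a = b, the vector
    [e_{2,1} v] spans a proper submodule, hence is zero; otherwise it is
    independent of [v]. *)
Lemma column_basis_exists : is_Lcol A L -> exists bas co, column_basis bas co.
Proof.
case=> v [gv v22]; case: pickP => [i /eqP ic|none]; last first.
  case=> v0 sp; have [co [lin coE]] := coordinate1 v0 sp.
  exists (fun q : bool => if q then 0 else v), (fun q u => if q then 0 else co u).
  have cu : c \notin uneq_columns.
    by rewrite inE; apply/existsP => -[i /andP[h _]]; have := none i; rewrite h.
  split=> //.
  - by move=> i ic; have := none i; rewrite ic eqxx.
  - by move=> i ic; have := none i; rewrite ic eqxx.
  - by move=> [] k u w; rewrite ?lin // mulr0 addr0.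
  - by move=> u; rewrite scale0r addr0.
  - have := coE v; move/eqP; rewrite -{1}[v]scale1r -subr_eq0 -scalerBl scaler_eq0.
    by rewrite subr_eq0 => /orP[/eqP <-//|/eqP].
  - by move/negP: cu.
case=> irr gen v11 v12.
have inc r r' : in_column par c r r'.
  have h r0 : has_box par r0 c.
    by case: (row_cases r0) => ->; [exact: has_box_row1 ic|exact: has_box_row2].
  by rewrite /in_column !h.
have v0 : v <> 0.
  move=> v0; case: irr => -[u u0] _; apply: u0.
  by have [x ->] := gen u; rewrite v0 linear0.
have podd : par row1 (+) par row2 = true.
  by have := rparP par; case: (par _); case: (par _).
have podd' : par row2 (+) par row1 = true by rewrite addbC.
have [_ ub] := ugen_rel F par (in_column par c).
pose x := smod_act u21 v.
have ord01 : (row1 == row2) = false by [].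
have ord10 : (row2 == row1) = false by [].
set l1 := (-1) ^+ par row1 * trow1 A i in v11.
set l2 := (-1) ^+ par row2 * trow2 A c in v22.
have x11 : smod_act u11 x = (l1 - 1) *: x.
  have := ub _ _ _ _ (inc row1 row1) (inc row2 row1).
  rewrite /brsgn addbb expr0 !scale1r ord01 scale0r eqxx mulr1 scale1r sub0r.
  move/(congr1 (fun a => smod_act a v)); rewrite smodDl !smodNl !smodM v11 linearZ /=.
  rewrite -/x => /eqP; rewrite subr_eq => /eqP ->.
  by rewrite scalerBl scale1r addrC.
have x22 : smod_act u22 x = (l2 + 1) *: x.
  have := ub _ _ _ _ (inc row2 row2) (inc row2 row1).
  rewrite /brsgn addbb expr0 !scale1r ?eqxx ord10 mulr0 scale0r subr0 ?scale1r.
  move/(congr1 (fun a => smod_act a v)); rewrite smodDl !smodNl !smodM v22 linearZ /=.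
  rewrite -/x => /eqP; rewrite subr_eq => /eqP ->.
  by rewrite scalerDl scale1r addrC.
have x12 : smod_act u12 x = (l1 + l2) *: v.
  have := ub _ _ _ _ (inc row1 row2) (inc row2 row1).
  rewrite /brsgn podd podd' expr1 ?eqxx ?mulr1 !scaleN1r !opprK ?scale1r.
  move/(congr1 (fun a => smod_act a v)); rewrite !smodDl !smodM v11 v12 v22 linear0.
  by rewrite addr0 scalerDl.
have x21 : smod_act u21 x = 0.
  have := ub _ _ _ _ (inc row2 row1) (inc row2 row1).
  rewrite /brsgn podd' expr1 ord01 ord10 mulr0 !scale0r subrr scaleN1r opprK.
  move/(congr1 (fun a => smod_act a v)); rewrite !smodDl !smodM smod0l -/x.
  by rewrite -mulr2n -scaler_nat => /eqP; rewrite scaler_eq0 (negbTE two_neq0) => /eqP.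
have gx : smod_gr true x.
  have g21 : ugr true u21 by rewrite -podd'; exact: ugr_gen.
  exact: (smod_act_gr (smodP L) g21 gv).
have spanU y a b : exists a' b', smod_act y (a *: v + b *: x) = a' *: v + b' *: x.
  elim/Ugl_ind: y a b => [k|r r'|y z hy hz|y z hy hz] a b.
  - exists (k * a), (k * b).
    by rewrite smodZl smod1 scalerDr !scalerA.
  - rewrite linearD !linearZ /=.
    case: (row_cases r) => ->; case: (row_cases r') => ->.
    + by exists (a * l1), (b * (l1 - 1)); rewrite v11 x11 !scalerA.
    + by exists (b * (l1 + l2)), 0; rewrite v12 x12 scaler0 add0r scalerA scale0r addr0.
    + by exists 0, a; rewrite -/x x21 scaler0 addr0 scale0r add0r.
    + by exists (a * l2), (b * (l2 + 1)); rewrite v22 x22 !scalerA.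
  - have [a1 [b1 E1]] := hy a b; have [a2 [b2 E2]] := hz a b.
    exists (a1 + a2), (b1 + b2).
    by rewrite smodDl E1 E2 addrACA -!scalerDl.
  - by have [a1 [b1 E1]] := hz a b; rewrite smodM E1; exact: hy.
have span u : exists a b, u = a *: v + b *: x.
  have [y ->] := gen u; have [a [b E]] := spanU y 1 0; exists a, b.
  by rewrite -E scale1r scale0r addr0.
have cb11 i' : topcol i' = c -> smod_act u11 v = ((-1) ^+ par row1 * trow1 A i') *: v.
  by move=> ic'; rewrite (topcol_inj (etrans ic' (esym ic))).
have cin : (c \in uneq_columns) = (trow1 A i != trow2 A c).
  rewrite inE; apply/existsP/idP => [[i' /andP[/eqP ic' h]]|h].
    by rewrite -(topcol_inj (etrans ic' (esym ic))).
  by exists i; rewrite ic eqxx.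
have l12 : l1 + l2 = (-1) ^+ par row1 * (trow1 A i - trow2 A c).
  rewrite /l1 /l2; move: podd; case: (par row1); case: (par row2) => //= _; ring.
have [eqab|neab] := eqVneq (trow1 A i) (trow2 A c).
  have l0 : l1 + l2 = 0 by rewrite l12 eqab subrr mulr0.
  have x0 : x = 0.
    pose N : set L := [set u | exists b, u = b *: x]%classic.
    have subN : is_subsupermod N.
      split.
      - by exists 0; rewrite scale0r.
      - move=> k u w [b1 ->] [b2 ->]; exists (k * b1 + b2).
        by rewrite scalerA scalerDl.
      - move=> y u [b ->]; elim/Ugl_ind: y b => [k|r r'|y z hy hz|y z hy hz] b.
        + by exists (k * b); rewrite smodZl smod1 scalerA.
        + rewrite linearZ /=.
          case: (row_cases r) => ->; case: (row_cases r') => ->.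
          * by exists (b * (l1 - 1)); rewrite x11 scalerA.
          * by exists 0; rewrite x12 l0 !scale0r scaler0.
          * by exists 0; rewrite x21 scale0r scaler0.
          * by exists (b * (l2 + 1)); rewrite x22 scalerA.
        + have [b1 E1] := hy b; have [b2 E2] := hz b.
          by exists (b1 + b2); rewrite smodDl E1 E2 scalerDl.
        + by have [b1 E1] := hz b; rewrite smodM E1; exact: hy.
      - move=> u0 u1 g0 g1 [b E].
        have u00 : u0 = 0.
          by rewrite -(even_partE g0 g1) E even_part_odd //; exact: smod_grZ.
        split; first by exists 0; rewrite u00 scale0r.
        by exists b; rewrite -E u00 add0r.
    case: irr => _ /(_ N subN) [N0|NT].
      have : N x by exists 1; rewrite scale1r.
      by rewrite N0.
    have : N v by rewrite NT.
    case=> b vb; case: v0; apply: (smod_disj (smodP L)) => //.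
    by rewrite vb; exact: smod_grZ.
  have [co [lin coE]] : exists co : L -> F,
      (forall k u w, co (k *: u + w) = k * co u + co w) /\ forall u, u = co u *: v.
    apply: coordinate1 => // u; have [a1 [b1 ->]] := span u.
    by exists a1; rewrite x0 scaler0 addr0.
  exists (fun q : bool => if q then 0 else v), (fun q u => if q then 0 else co u).
  split=> //.
  - by move=> [] k u w; rewrite ?lin // mulr0 addr0.
  - by move=> u; rewrite scale0r addr0.
  - have := coE v; move/eqP; rewrite -{1}[v]scale1r -subr_eq0 -scalerBl scaler_eq0.
    by rewrite subr_eq0 => /orP[/eqP <-//|/eqP].
  - by rewrite cin eqab eqxx.
have l0 : l1 + l2 != 0 by rewrite l12 mulf_neq0 ?signr_eq0 ?subr_eq0.
have ind a b : a *: v + b *: x = 0 -> a = 0 /\ b = 0.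
  move=> ab0; have := congr1 (smod_act u12) ab0.
  rewrite linearD !linearZ /= v12 x12 scaler0 add0r linear0 scalerA => /eqP.
  rewrite scaler_eq0 mulf_eq0 (negbTE l0) orbF => /orP[/eqP b0|/eqP//].
  move: ab0; rewrite b0 scale0r addr0 => /eqP.
  by rewrite scaler_eq0 => /orP[/eqP ->|/eqP].
have [co [lin coE co1]] := coordinate2 ind span.
exists (fun q : bool => if q then x else v), co; split=> //.
- exact: (co1 false false).
- by rewrite cin neab.
Qed.
End Columns.

(** * Outer tensor products of columns *)

Section OuterTensor.
Variables (F : fieldType) (par : parity_seq) (pi : pyramid).
Hypothesis two_neq0 : 2%:R != 0 :> F.
Variable A : tableau F pi.
Local Notation box := 'I_(nbox par pi).
Local Notation T := (uneq_columns A).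

Lemma dfwith_id (I : eqType) (U : I -> Type) (v : forall i, U i) c :
  dfwith v (v c) = v.
Proof. by apply: functional_extensionality_dep => i; case: dfwithP. Qed.

(** The tensor product is spanned by the [2 ^ #|T|] tensors that choose
    [e_{2,1} v] in a subset of the columns with unequal entries. Indeed sending a
    vector to its coordinates and back fixes every pure tensor, by expanding one
    factor at a time, so it is the identity by the universal property. *)
Lemma outer_V_highest (X : supermod (@ugr F _ (@bpar par pi) (@eq_col par pi))) :
  is_outer_V A X -> exists (w0 : X) (Psi : {linear 'rV[F]_(2 ^ #|T|) -> X}),
  [/\ w0 <> 0, smod_gr false w0,
      forall x, exists k, [/\ smod_act (ebarh F (x, x)) w0 = k *: w0,
        forall m : 'I_(top pi), brow x = row1 -> bcol x = (off pi + m.+1)%N ->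
          k = trow1 A m &
        forall m : 'I_(bot pi), brow x = row2 -> bcol x = m.+1 -> k = trow2 A m],
      forall i j : box, bcol i = bcol j -> brow i = row1 -> brow j = row2 ->
        smod_act (ugen _ _ _ i j) w0 = 0 &
      forall v, exists r, Psi r = v].
Proof.
case=> [Lc [t [hL ot]]].
have [bas [co cb]] : exists (bas : forall c, bool -> Lc c) (co : forall c, bool -> Lc c -> F),
    forall c, column_basis A (bas c) (co c).
  have h c : exists bc : (bool -> Lc c) * (bool -> Lc c -> F), column_basis A bc.1 bc.2.
    by have [b [o h]] := column_basis_exists two_neq0 (hL c); exists (b, o).
  exists (fun c => (sval (cid (h c))).1), (fun c => (sval (cid (h c))).2) => c.
  by case: cid.
pose basS (S : {set 'I_(bot pi)}) c := bas c (c \in S).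
pose N := #|powerset T|.
have NE : N = (2 ^ #|T|)%N by rewrite /N card_powerset.
pose ev (i : 'I_N) : {set 'I_(bot pi)} := @enum_val _ (mem (powerset T)) i.
pose Ps (r : 'rV[F]_N) : X := \sum_i r 0 i *: t (basS (ev i)).
have Ps_lin : linear Ps.
  move=> k u w; rewrite scaler_sumr -big_split; apply: eq_bigr => i _.
  by rewrite !mxE scalerDl scalerA.
pose b (v : forall c, Lc c) : 'rV[F]_N := \row_i \prod_c co c (c \in ev i) (v c).
have b_lin : multilinear b.
  move=> v c k x y; apply/rowP => i; rewrite !mxE.
  have E z : \prod_c0 co c0 (c0 \in ev i) (dfwith v z c0) =
      co c (c \in ev i) z *
      \prod_(c0 | c0 != c) co c0 (c0 \in ev i) (v c0).
    rewrite (bigD1 c) //= dfwith_in; congr (_ * _); apply: eq_bigr => c0 c0c.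
    by rewrite dfwith_out // eq_sym.
  by rewrite !E (cb_lin (cb c)) mulrDl mulrA.
have [g gE _] := otens_univ ot b_lin.
have tl := otens_lin ot.
have b_bas i : b (basS (ev i)) = delta_mx 0 i.
  apply/rowP => j; rewrite !mxE eqxx /= /basS.
  rewrite -(inj_eq (@enum_val_inj _ (mem (powerset T)))) -!/(ev _).
  have sub l c : c \in ev l -> c \in T.
    by have := enum_valP l; rewrite inE => /fintype.subsetP; apply.
  have [->|ne] := eqVneq (ev j) (ev i).
    rewrite big1 // => c _; have [cT|cT] := boolP (c \in T).
      by rewrite (cb_in (cb c) cT) eqxx.
    have /negbTE -> : c \notin ev i by apply: contraNN cT; exact: sub.
    exact: cb_1 (cb c).
  have [c cne] : exists c, (c \in ev j) != (c \in ev i).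
    apply/existsP; apply: contraNT ne; rewrite negb_exists => /forallP h.
    by apply/eqP/setP => c; apply/eqP; have := h c; rewrite negbK.
  have cT : c \in T.
    by move: cne; case E1: (c \in ev j); case E2: (c \in ev i) => // _;
      [exact: sub E1|exact: sub E2].
  by rewrite (bigD1 c) //= (cb_in (cb c) cT) (negbTE cne) mul0r.
have PsgS i : Ps (g (t (basS (ev i)))) = t (basS (ev i)).
  rewrite gE b_bas /Ps (bigD1 i) //= mxE !eqxx scale1r big1 ?addr0 // => j ji.
  by rewrite mxE (negbTE ji) andbF scale0r.
have Psg_lin : linear (fun x => Ps (g x)).
  by move=> k x y; rewrite linearP Ps_lin.
pose PG : {linear X -> X} := HB.pack (fun x => Ps (g x))
  (GRing.isLinear.Build F X X *:%R (fun x => Ps (g x)) Psg_lin).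
(* Induction on the number of initial factors that are not basis vectors. *)
have Psgt m v : (forall c : 'I_(bot pi), (m <= c)%N ->
    exists q, v c = bas c q /\ (q -> c \in T)) -> Ps (g (t v)) = t v.
  elim: m v => [|m IH] v hv.
    pose S := [set c | `[< exists q : bool, v c = bas c q /\ (q -> c \in T) /\ q >]].
    have ST : S \in powerset T.
      rewrite inE; apply/fintype.subsetP => c; rewrite inE => /asboolP [q [_ [h /h]]] //.
    have -> : v = basS (ev (enum_rank_in ST S)).
      rewrite /ev enum_rankK_in //; apply: functional_extensionality_dep => c.
      rewrite /basS inE; have [q [vq qT]] := hv c (leq0n _).
      case: asboolP => [[q' [-> [_ ->]]] //|h].
      by case: q vq qT => // vq qT; case: h; exists true; split=> //; split=> //; exact: qT.
    exact: PsgS.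
  have [lm|ml] := ltnP m (bot pi); last first.
    apply: IH => c mc; apply: hv; rewrite ltn_neqAle mc andbT.
    by apply: contraTneq (ltn_ord c) => <-; rewrite -leqNgt.
  pose c := Ordinal lm.
  have dec (q : bool) : (q -> c \in T) ->
      Ps (g (t (dfwith v (bas c q)))) = t (dfwith v (bas c q)).
    move=> qT; apply: IH => c'; case: dfwithP => [_|j cj mj]; first by exists q.
    by apply: hv; rewrite ltn_neqAle mj andbT.
  pose Phi : {linear Lc c -> X} := HB.pack (fun z : Lc c => t (dfwith v z))
    (GRing.isLinear.Build F (Lc c) X *:%R (fun z : Lc c => t (dfwith v z)) (tl v c)).
  have -> : t v = Phi (v c) by rewrite /= dfwith_id.
  rewrite (cb_co (cb c) (v c)) -[LHS]/(PG _) !linearD !linearZ /=.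
  congr (_ *: _ + _); first exact: dec.
  have [cT|cT] := boolP (c \in T); first by congr (_ *: _); exact: dec.
  rewrite (cb_out (cb c) cT) -[t _]/(Phi 0) -[Ps _]/(PG (Phi 0)).
  by rewrite !linear0.
have PGid x : Ps (g x) = x.
  have [h _ hu] := otens_univ ot tl.
  have e1 : PG =1 h by apply: hu => v; apply: (Psgt (bot pi)) => c; rewrite leqNgt ltn_ord.
  have e2 : (idfun : {linear X -> X}) =1 h by apply: hu.
  by rewrite -[LHS]/(PG x) e1 -e2.
pose w0 := t (fun c => bas c false).
have w0_gr : smod_gr false w0.
  have := otens_gr ot (q := fun=> false) (fun c => cb_even (cb c)).
  by rewrite big1.
have col_act (i j : box) (c : 'I_(bot pi)) : bcol i = c.+1 -> bcol j = c.+1 ->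
    smod_act (ugen F (@bpar par pi) (@eq_col par pi) i j) w0 =
    (-1) ^+ false *: t (dfwith (fun c => bas c false)
      (smod_act (ugen F par (in_column par c) (brow i) (brow j)) (bas c false))).
  move=> ic jc.
  have := otens_act ot (q := fun=> false) ic jc (fun c => cb_even (cb c)).
  by rewrite big1 // andbF.
have t_scale c k : t (dfwith (fun c => bas c false) (k *: bas c false)) = k *: w0.
  pose Phi : {linear Lc c -> X} := HB.pack
    (fun z : Lc c => t (dfwith (fun c => bas c false) z))
    (GRing.isLinear.Build F (Lc c) X *:%R
      (fun z : Lc c => t (dfwith (fun c => bas c false) z)) (tl (fun c => bas c false) c)).
  rewrite -[LHS]/(Phi _) linearZ /=; congr (_ *: t _).
  exact: (dfwith_id (fun c => bas c false) c).
have box_col (x : box) : exists c : 'I_(bot pi), bcol x = c.+1.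
  have [m mx xc] := box_index x.
  have lt : (row_off pi (brow x) + m < bot pi)%N.
    have [r|r] := row_cases (brow x); rewrite r in mx *.
      by apply: leq_trans (pyramidP pi); rewrite ltn_add2l.
    exact: mx.
  by exists (Ordinal lt); rewrite xc addnS.
have Ps_surj v : exists r, Ps r = v by exists (g v); exact: PGid.
pose PL : {linear 'rV[F]_N -> X} :=
  HB.pack Ps (GRing.isLinear.Build F 'rV[F]_N X *:%R Ps Ps_lin).
have [Psi Psi_surj] : exists Psi : {linear 'rV[F]_(2 ^ #|T|) -> X},
    forall v, exists r, Psi r = v.
  by rewrite -NE; exists PL.
exists w0, Psi; split=> //.
- move=> w00; have : g w0 = 0 by rewrite w00 linear0.
  have S0 : (finset.set0 : {set 'I_(bot pi)}) \in powerset T by rewrite inE finset.sub0set.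
  have -> : w0 = t (basS (ev (enum_rank_in S0 finset.set0))).
    congr t; apply: functional_extensionality_dep => c.
    by rewrite /basS /ev enum_rankK_in // inE.
  rewrite gE b_bas => /rowP /(_ (enum_rank_in S0 finset.set0)) /eqP.
  by rewrite !mxE !eqxx oner_eq0.
- move=> x; have [c xc] := box_col x.
  have sq q (k : F) : (-1) ^+ q * ((-1) ^+ q * k) = k by rewrite mulrA -expr2 sqrr_sign mul1r.
  have [r|r] := row_cases (brow x).
    have [i ic] : exists i : 'I_(top pi), topcol i = c.
      have [m mx xm] := box_index x; rewrite r in mx xm.
      exists (Ordinal (mx : (m < top pi)%N)); apply: val_inj => /=.
      by apply: succn_inj; rewrite -xc xm /row_off /= addnS.
    exists (trow1 A i); split=> [|m _ xm|m]; last by rewrite r.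
      rewrite /ebarh smodZl /= (col_act _ _ _ xc xc) expr0 scale1r r (cb_11 (cb c) ic).
      by rewrite t_scale scalerA /bpar r sq.
    congr trow1; apply: (@topcol_inj pi); rewrite ic; apply: val_inj => /=.
    by apply: succn_inj; rewrite -xc xm addnS.
  exists (trow2 A c); split=> [|m|m _ xm]; [|by rewrite r|].
    rewrite /ebarh smodZl /= (col_act _ _ _ xc xc) expr0 scale1r r (cb_22 (cb c)).
    by rewrite t_scale scalerA /bpar r sq.
  congr trow2; apply: val_inj; apply: succn_inj; by rewrite -xc xm.
- move=> i j ij ri rj; have [c ic] := box_col i.
  rewrite (col_act _ _ _ ic (etrans (esym ij) ic)) ri rj.
  have [m mx im] := box_index i; rewrite ri in mx im.
  have mc : topcol (Ordinal (mx : (m < top pi)%N)) = c.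
    by apply: val_inj; apply: succn_inj; rewrite -ic im /row_off /= addnS.
  rewrite (cb_12 (cb c) mc) -(scale0r (bas c false)) t_scale scale0r scaler0 //.
Qed.
End OuterTensor.

(** * Symmetric polynomials and matchings *)

Section Symmetric.
Variable F : fieldType.

Lemma esym_val0 n (a : 'I_n -> F) : esym_val a 0 = 1.
Proof.
rewrite /esym_val (big_pred1 finset.set0) ?big_set0 // => S.
by rewrite cards_eq0.
Qed.

Lemma esym_val_gt n (a : 'I_n -> F) r : (n < r)%N -> esym_val a r = 0.
Proof.
move=> nr; rewrite /esym_val big_pred0 // => S; apply/negbTE.
by rewrite neq_ltn (leq_ltn_trans (max_card _)) // card_ord.
Qed.

Lemma prod_XsubC_esym n (a : 'I_n -> F) :
  \prod_i ('X - (- a i)%:P) = \poly_(t < n.+1) esym_val a (n - t).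
Proof.
under eq_bigr do rewrite polyCN opprK addrC.
rewrite bigA_distr poly_def (reindex_inj rev_ord_inj) /=.
have revE (t : 'I_n.+1) : esym_val a (n - (n.+1 - t.+1)) *: 'X^(n.+1 - t.+1) =
    \sum_(S : {set 'I_n} | #|S| == t) (\prod_(i in S) a i) *: ('X^(n - t) : {poly F}).
  by rewrite subSS subKn ?scaler_suml // -ltnS.
rewrite [RHS](eq_bigr _ (fun t _ => revE t)).
rewrite (partition_big (fun S : {set 'I_n} => inord #|S| : 'I_n.+1) xpredT) //=.
apply: eq_bigr => t _; apply: eq_big => [S|S /eqP St].
  rewrite -val_eqE /= inordK // ltnS -[X in (_ <= X)%N]card_ord; exact: max_card.
rewrite (bigID (mem S)) /= -mul_polyC; congr (_ * _).
  by rewrite rmorph_prod; apply: eq_bigr => i /= ->.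
rewrite (eq_bigr (fun=> 'X)) => [|i /negbTE -> //].
rewrite prodr_const; congr (_ ^+ _).
have <- : #|S| = t.
  by rewrite -St inordK // ltnS -[X in (_ <= X)%N]card_ord max_card.
transitivity #|~: S|; last by rewrite cardsCs finset.setCK card_ord.
by apply: eq_card => i; rewrite !inE.
Qed.

(** Both are the coefficients of the same product of linear factors. *)
Lemma esym_val_perm n (a : 'I_n -> F) (g : {perm 'I_n}) r :
  esym_val (a \o g) r = esym_val a r.
Proof.
have E : \poly_(t < n.+1) esym_val (a \o g) (n - t) = \poly_(t < n.+1) esym_val a (n - t).
  rewrite -!prod_XsubC_esym [RHS](reindex_inj (@perm_inj _ g)) /=.
  by apply: eq_bigr.
have [nr|rn] := ltnP n r; first by rewrite !esym_val_gt.
have := congr1 (fun P : {poly F} => P`_(n - r)) E; rewrite !coef_poly.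
by rewrite ltnS leq_subr subKn.
Qed.

Lemma coprimep_prod_XsubC (I J : finType) (A : {set I}) (B : {set J})
    (a : I -> F) (b : J -> F) :
  (forall i j, i \in A -> j \in B -> a i != b j) ->
  coprimep (\prod_(i in A) ('X - (a i)%:P)) (\prod_(j in B) ('X - (b j)%:P)).
Proof.
move=> ab; apply: (big_rec (fun P => coprimep P _)) => [|i P iA cP]; first exact: coprime1p.
rewrite coprimepMl cP andbT coprimep_sym coprimep_XsubC; apply/negP.
rewrite /root horner_prod prodf_seq_eq0 => /hasP[j _ /andP[jB]].
by rewrite hornerXsubC subr_eq0 => /eqP e; have := ab i j iA jB; rewrite e eqxx.
Qed.
End Symmetric.

Section Matchings.
Variables (F : fieldType) (pi : pyramid).
Implicit Types A B : tableau F pi.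

Definition eq_boxes B : {set 'I_(top pi)} := [set i | trow1 B i == trow2 B (topcol i)].

Lemma matching_row_equiv A B h : row_equiv A B -> matching B h -> matching A h.
Proof.
move=> [[g1 g1E] [g2 g2E]] [i [j [ii ji E]]]; exists (g1 \o i), (g2 \o j); split.
- exact: inj_comp perm_inj ii.
- exact: inj_comp perm_inj ji.
- by move=> x /=; rewrite -g1E -g2E.
Qed.

Lemma card_uneq_columns B : #|uneq_columns B| = (top pi - equal_columns B)%N.
Proof.
have -> : uneq_columns B = @topcol pi @: ~: eq_boxes B.
  apply/setP => c; rewrite inE; apply/existsP/imsetP => [[i /andP[/eqP <- h]]|[j]].
    by exists i; rewrite // !inE.
  by rewrite !inE => h ->; exists j; rewrite eqxx.
rewrite card_imset; last exact: topcol_inj.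
by rewrite cardsCs finset.setCK card_ord.
Qed.

(** A matching using the columns with equal entries can be enlarged by a pair of
    equal entries outside of these columns: this is where maximality of the
    matching makes the numerator and the denominator coprime. *)
Lemma matching_extend B i c : trow1 B i = trow2 B c -> i \notin eq_boxes B ->
  c \notin @topcol pi @: eq_boxes B -> matching B (equal_columns B).+1.
Proof.
move=> ic iE cE; pose D := i |: eq_boxes B.
have szD : (equal_columns B).+1 = #|D| by rewrite cardsU1 iE.
pose iv x := enum_val (cast_ord szD x) : 'I_(top pi).
have ivD x : iv x = i \/ iv x \in eq_boxes B.
  by have := enum_valP (cast_ord szD x); rewrite 2!inE => /orP[/eqP|]; auto.
have iv_inj : injective iv by move=> x y /enum_val_inj /cast_ord_inj.
pose jv x := if iv x == i then c else topcol (iv x).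
exists iv, jv; split=> // [x y|x].
  rewrite /jv; case: eqP => xi; case: eqP => yi.
  - by move=> _; apply: iv_inj; rewrite xi yi.
  - by case: (ivD y) => // yE cy; case/negP: cE; rewrite cy imset_f.
  - by case: (ivD x) => // xE cy; case/negP: cE; rewrite -cy imset_f.
  - by move/topcol_inj/iv_inj.
rewrite /jv; case: eqP => [-> //|xi].
by case: (ivD x) => //; rewrite inE => /eqP.
Qed.
End Matchings.

(** * Homomorphisms from Verma modules *)

Lemma galg_set_rec (F : fieldType) (B : algType F) (G Q : B -> Prop) :
  Q 1 -> (forall x y, Q x -> Q y -> Q (x + y)) -> (forall c x, Q x -> Q (c *: x)) ->
  (forall x y, Q x -> Q y -> Q (x * y)) -> (forall x, G x -> Q x) ->
  forall y, galg_set G y -> Q y.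
Proof. by move=> Q1 QD QZ QM GQ y; elim; auto. Qed.

(** A highest weight vector [w0] of the right weight spans a one-dimensional module
    over W_pi^sharp isomorphic to C_A, so the universal property of the tensor
    product provides a homomorphism from the Verma module. That it commutes with
    the action and preserves parity follows from uniqueness. *)
Section VermaMap.
Variables (F : fieldType) (par : parity_seq) (pi : pyramid) (s : 'M[nat]_2).
Local Notation W := (Wpi F par pi).
Local Notation gW := (@Wgr F par pi).
Hypothesis W_split : forall w : W, exists u v, [/\ gW false u, gW true v & w = u + v].
Variables (A : tableau F pi) (prj : {lrmorphism Wsharp F par pi s -> W0 F par pi}).
Variables (C : supermod (@W0gr F par pi)) (v : C).
Hypotheses (sharp : is_sharp_proj prj) (CA : is_CA A v).
Variables (M : supermod gW) (t : W -> C -> M).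
Hypothesis tens : is_tensor prj t.
Variables (V : supermod gW) (w0 : V).
Hypothesis w0_even : smod_gr false w0.
Hypothesis d1w0 : forall (x : W) r, (0 < r <= top pi)%N ->
  subalg_val x = d_gen F par pi row1 r -> smod_act x w0 = esym_val (trow1 A) r *: w0.
Hypothesis d2w0 : forall (x : W) r, (0 < r <= bot pi)%N ->
  subalg_val x = d_gen F par pi row2 r -> smod_act x w0 = esym_val (trow2 A) r *: w0.
Hypothesis ew0 : forall (x : W) r, (s row1 row2 < r)%N ->
  subalg_val x = e_gen F par pi r -> smod_act x w0 = 0.

Let Q0 (y : W) := exists z : W0 F par pi, subalg_val z = y /\
  exists k, smod_act z v = k *: v /\ smod_act y w0 = k *: w0.

Let W0_char (y : W) : galg_set (@W0_set F par pi) y -> Q0 y.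
Proof.
move: y.
case: CA => _ _ c1 c2.
have Q1 : Q0 1.
  by exists 1; split=> //; exists 1; rewrite !smod1 !scale1r.
have QD x y' : Q0 x -> Q0 y' -> Q0 (x + y').
  move=> [z1 [<- [k1 [h1 g1]]]] [z2 [<- [k2 [h2 g2]]]]; exists (z1 + z2).
  by split=> //; exists (k1 + k2); rewrite !smodDl h1 h2 g1 g2 !scalerDl.
have QZ c x : Q0 x -> Q0 (c *: x).
  move=> [z1 [<- [k1 [h1 g1]]]]; exists (c *: z1).
  by split=> //; exists (c * k1); rewrite !smodZl h1 g1 !scalerA.
have QM x y' : Q0 x -> Q0 y' -> Q0 (x * y').
  move=> [z1 [<- [k1 [h1 g1]]]] [z2 [<- [k2 [h2 g2]]]]; exists (z1 * z2).
  split=> //; exists (k2 * k1).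
  by rewrite !smodM h2 g2 !linearZ /= h1 g1 !scalerA.
apply: (galg_set_rec Q1 QD QZ QM) => x; move: x.
apply: (galg_set_rec Q1 QD QZ QM) => x' [i [r [ri xE]]].
have x'G : x' \in galg_pred (@W0_set F par pi).
  by apply/asboolP; apply: galg_gen; apply: galg_gen; exists i, r.
exists (Subalg x'G); split=> //.
case: (row_cases i) => ii; rewrite {i}ii in ri xE.
  by exists (esym_val (trow1 A) r); rewrite (c1 _ r) ?(d1w0 (r := r)).
by exists (esym_val (trow2 A) r); rewrite (c2 _ r) ?(d2w0 (r := r)).
Qed.

Let sharp_char (x : Wsharp F par pi s) :
  exists k, smod_act (prj x) v = k *: v /\ smod_act (subalg_val x) w0 = k *: w0.
Proof.
pose Q y := exists x : Wsharp F par pi s, subalg_val x = y /\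
  exists k, smod_act (prj x) v = k *: v /\ smod_act y w0 = k *: w0.
have Q1 : Q 1.
  by exists 1; split=> //; exists 1; rewrite rmorph1 !smod1 !scale1r.
have QD y y' : Q y -> Q y' -> Q (y + y').
  move=> [z1 [<- [k1 [h1 g1]]]] [z2 [<- [k2 [h2 g2]]]]; exists (z1 + z2).
  by split=> //; exists (k1 + k2); rewrite rmorphD !smodDl h1 h2 g1 g2 !scalerDl.
have QZ c y : Q y -> Q (c *: y).
  move=> [z1 [<- [k1 [h1 g1]]]]; exists (c *: z1).
  by split=> //; exists (c * k1); rewrite linearZ !smodZl h1 g1 !scalerA.
have QM y y' : Q y -> Q y' -> Q (y * y').
  move=> [z1 [<- [k1 [h1 g1]]]] [z2 [<- [k2 [h2 g2]]]]; exists (z1 * z2).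
  split=> //; exists (k2 * k1).
  by rewrite rmorphM !smodM h2 g2 !linearZ /= h1 g1 !scalerA.
suff [y [yx [k [h1 h2]]]] : Q (subalg_val x).
  have e : y = x by exact: val_inj.
  by exists k; rewrite -{1}e h1.
have : galg_set (@Wsharp_set F par pi s) (subalg_val x).
  by case: x => /= y /asboolP.
move: (subalg_val x : W).
apply: (galg_set_rec Q1 QD QZ QM) => {x} x; move: x.
apply: (galg_set_rec Q1 QD QZ QM) => y' y'G.
have y'S : y' \in galg_pred (@Wsharp_set F par pi s).
  by apply/asboolP; apply: galg_gen; apply: galg_gen.
case: y'G => [y'0|[r sr y'E]].
  have [z [zy [k [h1 h2]]]] := W0_char (galg_gen y'0).
  exists (Subalg y'S); split=> //; exists k; split=> //.
  by rewrite (proj1 sharp z).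
exists (Subalg y'S); split=> //; exists 0; case/andP: sr => sr _.
by rewrite (proj2 sharp _ r) // smod0l (ew0 sr) // !scale0r.
Qed.

Lemma verma_map : exists2 g : {linear M -> V}, is_shom g &
  forall w, g (t w v) = smod_act w w0.
Proof.
case: CA => gv [v0 vs] _ _.
have [co [co_lin coE]] := coordinate1 v0 vs.
have co_lin' : linear (co : C -> F^o) by exact: co_lin.
have coZ k u : co (k *: u) = k * co u.
  have c0 : co 0 = 0.
    by have := co_lin (-1) 0 0; rewrite scaler0 addr0 mulN1r addNr.
  by have := co_lin k u 0; rewrite c0 !addr0.
have cov : co v = 1.
  have := coE v; move/eqP; rewrite -{1}[v]scale1r -subr_eq0 -scalerBl scaler_eq0.
  by rewrite subr_eq0 => /orP[/eqP <-//|/eqP].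
pose b (w : W) (u : C) : V := co u *: smod_act w w0.
have b_bal : balanced prj b.
  split=> [u c x y|w c u u'|w x u].
  - by rewrite /b smodDl smodZl scalerDr !scalerA mulrC.
  - by rewrite /b co_lin scalerDl scalerA.
  have [k [h1 h2]] := sharp_char x.
  have pu : smod_act (prj x) u = (co u * k) *: v.
    by rewrite {1}(coE u) linearZ /= h1 scalerA.
  by rewrite /b pu coZ cov mulr1 smodM h2 linearZ /= scalerA.
have comp_bal (f : {linear V -> V}) : balanced prj (fun w u => f (b w u)).
  case: b_bal => b1 b2 b3; split=> [u c x y|w c u u'|w x u].
  - by rewrite b1 linearP.
  - by rewrite b2 linearP.
  - by rewrite b3.
have [g gE _] := tens_univ tens b_bal.
(* Linear maps out of [M] that come from balanced maps agree if they agree on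
   tensors; this serves for the action and for the parity projections. *)
have eq_on (f1 : {linear M -> M}) (f2 : {linear V -> V}) :
    (forall w u, g (f1 (t w u)) = f2 (b w u)) -> forall m, g (f1 m) = f2 (g m).
  move=> h m; have [g' _ g'u] := tens_univ tens (comp_bal f2).
  have e1 : (g \o f1 : {linear M -> V}) =1 g' by apply: g'u.
  have e2 : (f2 \o g : {linear M -> V}) =1 g' by apply: g'u => w u /=; rewrite gE.
  by rewrite -[LHS]/((g \o f1) m) e1 -e2.
exists g; last by move=> w; rewrite gE /b cov scale1r.
split=> [a m|].
  apply: (eq_on (smod_act a) (smod_act a)) => w u.
  by rewrite /= (tens_act tens) gE /b smodM linearZ.
apply: even_part_hom => m; apply: (eq_on (@even_part _ _ _ M) (@even_part _ _ _ V)) => w u.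
have [wa [wb [ga gb ->]]] := W_split w.
have gu : smod_gr false u by rewrite (coE u); exact: smod_grZ.
have t_add : t (wa + wb) u = t wa u + t wb u.
  by case: (tens_bal tens) => t1 _ _; have := t1 u 1 wa wb; rewrite !scale1r.
rewrite /= t_add even_partE; last 2 first.
- exact: (tens_gr tens ga gu).
- exact: (tens_gr tens gb gu).
rewrite gE /b smodDl scalerDr even_partE //; apply: smod_grZ.
  exact: (smod_act_gr (smodP V) ga w0_even).
exact: (smod_act_gr (smodP V) gb w0_even).
Qed.
End VermaMap.

(** * Irreducible quotients of Verma modules are standard *)

(** The homogeneous components of an element of W_pi lie in W_pi because the
    Drinfeld generators are homogeneous. *)
Lemma drinfeld_split (F : fieldType) (par : parity_seq) (pi : pyramid) (s : 'M[nat]_2)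
    (d : 'I_2 -> nat -> Wpi F par pi) (e f : nat -> Wpi F par pi) :
  drinfeld_rels par pi s d e f ->
  drinfeld_universal d e f s ->
  (forall i r, (0 < r)%N -> Wgr false (d i r)) ->
  (forall r, (s row1 row2 < r)%N -> Wgr true (e r)) ->
  (forall r, (s row2 row1 < r)%N -> Wgr true (f r)) ->
  forall w : Wpi F par pi, exists u v, [/\ Wgr false u, Wgr true v & w = u + v].
Proof.
move=> rels univ grd gre grf; apply: (drinfeld_ind rels univ).
- exists 1, 0; split; [exact: ugr1|exact: ugr0|by rewrite addr0].
- move=> _ _ [u1 [v1 [gu1 gv1 ->]]] [u2 [v2 [gu2 gv2 ->]]].
  exists (u1 + u2), (v1 + v2); split; [exact: ugrD|exact: ugrD|by rewrite addrACA].
- move=> c _ [u1 [v1 [gu1 gv1 ->]]]; exists (c *: u1), (c *: v1).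
  by split; [exact: ugrZ|exact: ugrZ|rewrite scalerDr].
- move=> _ _ [u1 [v1 [gu1 gv1 ->]]] [u2 [v2 [gu2 gv2 ->]]].
  exists (u1 * u2 + v1 * v2), (u1 * v2 + v1 * u2); split.
  + by apply: ugrD; [exact: (ugrM gu1 gu2)|exact: (ugrM gv1 gv2)].
  + by apply: ugrD; [exact: (ugrM gu1 gv2)|exact: (ugrM gv1 gu2)].
  + by rewrite mulrDl !mulrDr -!addrA; congr (_ + _); rewrite addrA addrC.
- by move=> i r r0; exists (d i r), 0; split; [exact: grd|exact: ugr0|rewrite addr0].
- by move=> r sr; exists 0, (e r); split; [exact: ugr0|exact: gre|rewrite add0r].
- by move=> r sr; exists 0, (f r); split; [exact: ugr0|exact: grf|rewrite add0r].
Qed.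

Section Main.
Variables (F : fieldType) (par : parity_seq) (pi : pyramid) (s : 'M[nat]_2).
Hypothesis two_neq0 : 2%:R != 0 :> F.

(** The standard module is an irreducible quotient of the Verma module, hence is
    isomorphic to the unique one. *)
Lemma Lbar_iso_Vbar : compatible pi s -> drinfeld_presentation F par pi s ->
  forall (A B : tableau F pi) (h : nat),
  max_matching A h -> row_equiv A B -> equal_columns B = h ->
  forall L V : supermod (@Wgr F par pi), is_Lbar s A L -> is_Vbar B V ->
  sisom L V /\ has_dim L (2 ^ (top pi - h)).
Proof.
move=> [_ _ Hs] [d [e [f [agree [grd gre grf] rels univ]]]] A B h [_ hmax] AB Bh L V.
case=> M [prj [C [v [t [sharp CA tens]]]]] [irrL _ uniqL] [X outX ->] {V}.
set V := pullback _ X.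
have bot_top : bot pi = (top pi + (s row1 row2 + s row2 row1))%N.
  by case: ifP Hs => [_ [-> ->]|/negbT]; [|rewrite -eqn0Ngt => /eqP -> ->]; lia.
have [agd age agf] := agree.
have [w0 [Psi [w0n0 w0gr diag up Psi_surj]]] := outer_V_highest two_neq0 outX.
have [val valP] : exists val : 'I_(nbox par pi) -> F, forall x,
    [/\ smod_act (ebarh F (x, x)) w0 = val x *: w0,
        forall m : 'I_(top pi), brow x = row1 -> bcol x = (off pi + m.+1)%N ->
          val x = trow1 B m &
        forall m : 'I_(bot pi), brow x = row2 -> bcol x = m.+1 -> val x = trow2 B m].
  by exists (fun x => sval (cid (diag x))) => x; case: cid.
have diag' x : smod_act (ebarh F (x, x)) w0 = val x *: w0 by case: (valP x).
have d1X (x : Wpi F par pi) r : (0 < r)%N -> subalg_val x = d_gen F par pi row1 r ->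
    smod_act (mu F par pi x) w0 = esym_val (trow1 B) r *: w0.
  move=> r0 xE.
  apply: (mu_d_row diag' (i := row1) (z := 0) (a := trow1 B) r0 erefl xE) => //.
    by move=> y m; case: (valP y) => _ h1 _ yr yc; exact: h1.
  exact: act_start1 up.
have d2X (x : Wpi F par pi) r : (0 < r)%N -> subalg_val x = d_gen F par pi row2 r ->
    smod_act (mu F par pi x) w0 = esym_val (trow2 B) r *: w0.
  move=> r0 xE.
  apply: (mu_d_row diag' (i := row2) (z := 1) (a := trow2 B) r0 erefl xE) => //.
    by move=> y m; case: (valP y) => _ _ h2 yr yc; exact: h2.
  by move=> y l p fl y1 y2; have [_] := act_end2 up p fl y2; exact.
have eX (x : Wpi F par pi) r : (s row1 row2 < r)%N -> subalg_val x = e_gen F par pi r ->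
    smod_act (mu F par pi x) w0 = 0.
  by move=> sr xE; apply: (mu_e up _ xE); exact: leq_ltn_trans sr.
pose E := eq_boxes B.
pose P : {poly F} := \prod_(i in ~: E) ('X - (- trow1 B i)%:P).
pose G : {poly F} := \prod_(i in E) ('X - (- trow1 B i)%:P).
pose Q : {poly F} := \prod_(c in ~: (@topcol pi @: E)) ('X - (- trow2 B c)%:P).
have PGE : P * G = \poly_(r < (top pi).+1) esym_val (trow1 B) (top pi - r).
  rewrite -prod_XsubC_esym [RHS](bigID (mem E)) /= mulrC; congr (_ * _).
  by apply: eq_bigl => i; rewrite !inE.
have QGE : Q * G = \poly_(r < (bot pi).+1) esym_val (trow2 B) (bot pi - r).
  rewrite -prod_XsubC_esym [RHS](bigID (mem (@topcol pi @: E))) /= mulrC; congr (_ * _).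
    rewrite big_imset /=; last by move=> i j _ _; exact: topcol_inj.
    by apply: eq_bigr => i; rewrite inE => /eqP ->.
  by apply: eq_bigl => i; rewrite !inE.
have card_uneq : #|~: E| = (top pi - h)%N.
  by rewrite cardsCs finset.setCK card_ord -Bh.
have cardT : #|uneq_columns B| = (top pi - h)%N by rewrite card_uneq_columns Bh.
have szP : size P = (top pi - h).+1.
  by rewrite /P -big_enum size_prod_XsubC -cardE card_uneq.
have PQ : coprimep P Q.
  apply: coprimep_prod_XsubC => i c; rewrite inE => iE; rewrite inE => cE.
  apply/negP => /eqP /oppr_inj ic.
  have := hmax _ (matching_row_equiv AB (matching_extend ic iE cE)).
  by rewrite Bh ltnn.
rewrite cardT in Psi Psi_surj.
have [orbV dimV irrV] := @highest_weight_irreducible F par pi s two_neq0 d e f rels univ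
  bot_top V w0 (esym_val (trow1 B)) (esym_val (trow2 B)) w0n0
  (esym_val0 _) (@esym_val_gt _ _ (trow1 B)) (esym_val0 _) (@esym_val_gt _ _ (trow2 B))
  (fun r hr => d1X _ _ (proj1 (andP hr)) (agd _ _ (proj1 (andP hr))))
  (fun r r0 => d2X _ _ r0 (agd _ _ r0))
  (fun r sr => eX _ _ sr (age _ sr))
  _ P Q G (monic_prod_XsubC _ _ _) (monic_prod_XsubC _ _ _) szP PQ PGE QGE Psi Psi_surj.
have W_split (w : Wpi F par pi) : exists u v, [/\ Wgr false u, Wgr true v & w = u + v].
  exact: (drinfeld_split rels univ grd gre grf).
have [esA1 esA2] : esym_val (trow1 B) =1 esym_val (trow1 A) /\
    esym_val (trow2 B) =1 esym_val (trow2 A).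
  case: AB => [[g1 g1E] [g2 g2E]]; split=> r.
    rewrite -(esym_val_perm (trow1 A) g1); apply: eq_bigr => S _; apply: eq_bigr => i _.
    exact: g1E.
  rewrite -(esym_val_perm (trow2 A) g2); apply: eq_bigr => S _; apply: eq_bigr => i _.
  exact: g2E.
have [g ghom gE] := @verma_map F par pi s W_split A prj C v sharp CA M t tens V w0 w0gr
  (fun x r hr xE => etrans (d1X x r (proj1 (andP hr)) xE) (congr1 (fun c => c *: w0) (esA1 r)))
  (fun x r hr xE => etrans (d2X x r (proj1 (andP hr)) xE) (congr1 (fun c => c *: w0) (esA2 r)))
  eX.
have LV : sisom L V.
  apply: sisom_sym; apply: uniqL => //; exists g => // w.
  by have [a ->] := orbV w; exists (t a v); rewrite gE.
by split=> //; exact: sisom_has_dim LV dimV.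
Qed.
End Main.

Theorem theorem8p4 (R : realType) (par : parity_seq) (pi : pyramid)
    (s : 'M[nat]_2) (Hs : compatible pi s)
    (Hdrinfeld : drinfeld_presentation R[i] par pi s)
    (A B : tableau R[i] pi) (h : nat)
    (Hh : max_matching A h) (HAB : row_equiv A B) (HB : equal_columns B = h)
    (L V : supermod (@Wgr R[i] par pi))
    (HL : is_Lbar s A L) (HV : is_Vbar B V) :
  sisom L V /\ has_dim L (2 ^ (top pi - h)).
Proof.
by apply: Lbar_iso_Vbar Hs Hdrinfeld _ _ _ Hh HAB HB _ _ HL HV; rewrite Num.Theory.pnatr_eq0.
Qed.
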